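(* Let $0<\delta\le\mu_g/(2l_{f,1})$ and suppose the regularity assumptions (R1)--(R4) of the context hold. Let $x\in\mathbb{R}^{d_x}$ be a given point such that, for every $t\in[0,\delta]$: (1) $y^*_t(x)$ satisfies LICQ, its active set equals a common set $\mathcal{I}$ (the active set of $y^*(x)$), and its Lagrange multiplier $\lambda^*_t(x)$ satisfies $[\lambda^*_t(x)]_i>0$ for all $i\in\mathcal{I}$ and $\|\lambda^*_t(x)\|\le\Lambda$; (2) the matrix $\nabla_y\bar h(x,y^*_t(x))$, consisting of the gradients $\nabla_y h_i(x,y_t^*(x))$, $i\in\mathcal{I}$, has largest singular value at most $s_{\max}$ and smallest singular value at least $s_{\min}>0$. Here $\Lambda,s_{\max},s_{\min}$ are $O(1)$ constants, i.e. independent of $\delta$. Then $$\|\nabla\Phi(x)-\nabla\Phi_\delta(x)\|\le O(\delta),$$ that is, $\|\nabla\Phi(x)-\nabla\Phi_\delta(x)\|\le C\delta$ with a constant $C$ that depends only on the constants appearing in the assumptions ($\mu_g$, the Lipschitz constants of $f,g,h$ and their derivatives, $d_h$, $\Lambda$, $s_{\max}$, $s_{\min}$) and not on $\delta$.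
   Context: Let $f,g:\mathbb{R}^{d_x}\times\mathbb{R}^{d_y}\to\mathbb{R}$ be continuously differentiable, $h=(h_1,\dots,h_{d_h}):\mathbb{R}^{d_x}\times\mathbb{R}^{d_y}\to\mathbb{R}^{d_h}$, $\mathcal{Y}(x)=\{y\in\mathbb{R}^{d_y}:h(x,y)\le0\}$ (componentwise). Define $y^*(x)=\arg\min_{y\in\mathcal{Y}(x)}g(x,y)$, $\Phi(x)=f(x,y^*(x))$, for $t\ge0$ $y^*_t(x)=\arg\min_{y\in\mathcal{Y}(x)}\{t f(x,y)+g(x,y)\}$ (so $y^*_0=y^*$), and $$\Phi_\delta(x)=\min_{y\in\mathcal{Y}(x)}\max_{z\in\mathcal{Y}(x)}\Big\{f(x,y)+\tfrac1\delta[g(x,y)-g(x,z)]\Big\}.$$ Regularity assumptions (''jointly over $\mathcal{X}\times\mathcal{Y}(x)$'' means on $\{(x,y):x\in\mathbb{R}^{d_x},y\in\mathcal{Y}(x)\}$): (R1) for every $x$, $\mathcal{Y}(x)$ is nonempty, closed and convex, and $\inf_x\Phi(x)>-\infty$. (R2) $f,\nabla f,\nabla g$ are Lipschitz with constants $l_{f,0},l_{f,1},l_{g,1}$, jointly over $\mathcal{X}\times\mathcal{Y}(x)$. (R3) for every $x$, $g(x,\cdot)$ is $\mu_g$-strongly convex on $\mathcal{Y}(x)$, $\mu_g>0$. (R4) $\nabla^2f,\nabla^2g$ are Lipschitz with constants $l_{f,2},l_{g,2}$, and for each $i\in[d_h]$, $h_i(x,y)$ is convex in $y$ and $h_i,\nabla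 h_i,\nabla^2h_i$ are Lipschitz with constants $l_{h,0},l_{h,1},l_{h,2}$, all jointly over $\mathcal{X}\times\mathcal{Y}(x)$. The active set of $y\in\mathcal{Y}(x)$ is $\mathcal{I}_y=\{i\in[d_h]:h_i(x,y)=0\}$. LICQ holds at $y$ if the vectors $\nabla_yh_i(x,y)$, $i\in\mathcal{I}_y$, are linearly independent. The Lagrange multiplier $\lambda^*_t(x)\in\mathbb{R}^{d_h}_{+}$ is the (under LICQ unique) vector $\lambda\ge 0$ satisfying the KKT conditions $t\nabla_yf(x,y^*_t(x))+\nabla_yg(x,y^*_t(x))+\sum_i\lambda_i\nabla_yh_i(x,y^*_t(x))=0$ and $\lambda_ih_i(x,y^*_t(x))=0$ for all $i$. *)

(* Defs.v *)
From HB Require Import structures.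
From mathcomp Require Import all_boot all_order all_algebra.
From mathcomp Require Import all_classical all_reals all_analysis.

Set Implicit Arguments.
Unset Strict Implicit.
Unset Printing Implicit Defensive.

Import Order.TTheory GRing.Theory Num.Theory.
Import numFieldNormedType.Exports.

Local Open Scope classical_set_scope.
Local Open Scope ring_scope.

(* The library norm `|v| on 'rV[R]_n is the sup norm; norms of vectors are
   Euclidean here, and norms of matrices are the induced operator norms. *)
Definition enorm (R : realType) (n : nat) (v : 'rV[R]_n) : R :=
  Num.sqrt (\sum_i v ord0 i ^+ 2).

Definition opnorm (R : realType) (m n : nat) (A : 'M[R]_(m, n)) : R :=
  sup [set enorm (v *m A) | v in [set v : 'rV[R]_m | enorm v <= 1]].

(* Singular values: square roots of the eigenvalues of the smaller of the two
   Gram matrices, so that an m x n matrix has minn m n of them (counted with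
   multiplicity). *)
Definition singular_value (R : realType) (m n : nat) (A : 'M[R]_(m, n))
    (s : R) : Prop :=
  0 <= s /\
  if (m <= n)%N then eigenvalue (A *m A^T) (s ^+ 2)
  else eigenvalue (A^T *m A) (s ^+ 2).

Definition grad (R : realType) (n : nat) (F : 'rV[R]_n -> R) (p : 'rV[R]_n) :
    'rV[R]_n :=
  \row_i 'D_(delta_mx ord0 i) F p.

Definition hess (R : realType) (n : nat) (F : 'rV[R]_n -> R) (p : 'rV[R]_n) :
    'M[R]_n :=
  jacobian (grad F) p.

Definition cont_diff (R : realType) (n : nat) (F : 'rV[R]_n -> R) : Prop :=
  (forall p, differentiable F p) /\ continuous (grad F).

Definition twice_differentiable_at (R : realType) (n : nat)
    (F : 'rV[R]_n -> R) (p : 'rV[R]_n) : Prop :=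
  (\forall q \near p, differentiable F q) /\ differentiable (grad F) p.

Definition lipschitz_for (R : realType) (n : nat) (V : zmodType)
    (N : V -> R) (D : set 'rV[R]_n) (l : R) (F : 'rV[R]_n -> V) : Prop :=
  forall p q, D p -> D q -> N (F p - F q) <= l * enorm (p - q).

Definition strongly_convex_on (R : realType) (n : nat) (mu : R)
    (D : set 'rV[R]_n) (F : 'rV[R]_n -> R) : Prop :=
  forall (y z : 'rV[R]_n) (s : R), D y -> D z -> 0 <= s <= 1 ->
    F (s *: y + (1 - s) *: z) <=
      s * F y + (1 - s) * F z - mu / 2 * s * (1 - s) * enorm (y - z) ^+ 2.

Definition argmin (R : realType) (T : pointedType) (D : set T) (F : T -> R) :
    T :=
  get [set y | D y /\ forall z, D z -> F y <= F z].

(* A function of (x, y) seen as a function on R^(dx + dy), so that grad and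
   hess give the joint derivatives. *)
Definition joint (R : realType) (dx dy : nat)
    (F : 'rV[R]_dx -> 'rV[R]_dy -> R) (p : 'rV[R]_(dx + dy)) : R :=
  F (lsubmx p) (rsubmx p).

Definition grad_y (R : realType) (dx dy : nat)
    (F : 'rV[R]_dx -> 'rV[R]_dy -> R) (x : 'rV[R]_dx) (y : 'rV[R]_dy) :
    'rV[R]_dy :=
  grad (F x) y.

Definition feasible (R : realType) (dx dy dh : nat)
    (h : 'I_dh -> 'rV[R]_dx -> 'rV[R]_dy -> R) (x : 'rV[R]_dx) :
    set 'rV[R]_dy :=
  [set y | forall i, h i x y <= 0].

Definition feasible_joint (R : realType) (dx dy dh : nat)
    (h : 'I_dh -> 'rV[R]_dx -> 'rV[R]_dy -> R) : set 'rV[R]_(dx + dy) :=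
  [set p | feasible h (lsubmx p) (rsubmx p)].

Definition ystar (R : realType) (dx dy dh : nat)
    (g : 'rV[R]_dx -> 'rV[R]_dy -> R)
    (h : 'I_dh -> 'rV[R]_dx -> 'rV[R]_dy -> R) (x : 'rV[R]_dx) : 'rV[R]_dy :=
  argmin (feasible h x) (g x).

Definition ystar_t (R : realType) (dx dy dh : nat)
    (f g : 'rV[R]_dx -> 'rV[R]_dy -> R)
    (h : 'I_dh -> 'rV[R]_dx -> 'rV[R]_dy -> R) (t : R) (x : 'rV[R]_dx) :
    'rV[R]_dy :=
  argmin (feasible h x) (fun y => t * f x y + g x y).

Definition Phi (R : realType) (dx dy dh : nat)
    (f g : 'rV[R]_dx -> 'rV[R]_dy -> R)
    (h : 'I_dh -> 'rV[R]_dx -> 'rV[R]_dy -> R) (x : 'rV[R]_dx) : R :=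
  f x (ystar g h x).

(* inf and sup stand for min and max: under R1-R3 and
   2 * l_{f,1} * delta <= mu_g both are attained. *)
Definition Phi_delta (R : realType) (dx dy dh : nat)
    (f g : 'rV[R]_dx -> 'rV[R]_dy -> R)
    (h : 'I_dh -> 'rV[R]_dx -> 'rV[R]_dy -> R) (delta : R) (x : 'rV[R]_dx) :
    R :=
  inf [set sup [set f x y + delta^-1 * (g x y - g x z) | z in feasible h x]
      | y in feasible h x].

Definition R1 (R : realType) (dx dy dh : nat)
    (f g : 'rV[R]_dx -> 'rV[R]_dy -> R)
    (h : 'I_dh -> 'rV[R]_dx -> 'rV[R]_dy -> R) : Prop :=
  (forall x, [/\ feasible h x !=set0, closed (feasible h x) &
     convex_set (feasible h x : set (convex_lmodType 'rV[R]_dy))]) /\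
  has_lbound (range (Phi f g h)).

Definition R2 (R : realType) (dx dy dh : nat)
    (f g : 'rV[R]_dx -> 'rV[R]_dy -> R)
    (h : 'I_dh -> 'rV[R]_dx -> 'rV[R]_dy -> R) (lf0 lf1 lg1 : R) : Prop :=
  [/\ lipschitz_for (@Num.norm R R) (feasible_joint h) lf0 (joint f),
      lipschitz_for (@enorm R _) (feasible_joint h) lf1 (grad (joint f)) &
      lipschitz_for (@enorm R _) (feasible_joint h) lg1 (grad (joint g))].

Definition R3 (R : realType) (dx dy dh : nat)
    (g : 'rV[R]_dx -> 'rV[R]_dy -> R)
    (h : 'I_dh -> 'rV[R]_dx -> 'rV[R]_dy -> R) (mu : R) : Prop :=
  forall x, strongly_convex_on mu (feasible h x) (g x).

(* Existence of the derivatives is required only at the points of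
   feasible_joint h, where the Lipschitz bounds are imposed; they are
   derivatives in the full space R^(dx + dy). *)
Definition R4 (R : realType) (dx dy dh : nat)
    (f g : 'rV[R]_dx -> 'rV[R]_dy -> R)
    (h : 'I_dh -> 'rV[R]_dx -> 'rV[R]_dy -> R)
    (lf2 lg2 lh0 lh1 lh2 : R) : Prop :=
  let D := feasible_joint h in
  [/\ forall p, D p ->
        twice_differentiable_at (joint f) p /\
        twice_differentiable_at (joint g) p,
      lipschitz_for (@opnorm R _ _) D lf2 (hess (joint f)),
      lipschitz_for (@opnorm R _ _) D lg2 (hess (joint g)) &
      forall i,
        [/\ forall p, D p -> twice_differentiable_at (joint (h i)) p,
            forall x, convex_function
              (feasible h x : set (convex_lmodType 'rV[R]_dy)) (h i x),
            lipschitz_for (@Num.norm R R) D lh0 (joint (h i)),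
            lipschitz_for (@enorm R _) D lh1 (grad (joint (h i))) &
            lipschitz_for (@opnorm R _ _) D lh2 (hess (joint (h i)))]].

Definition active (R : realType) (dx dy dh : nat)
    (h : 'I_dh -> 'rV[R]_dx -> 'rV[R]_dy -> R) (x : 'rV[R]_dx)
    (y : 'rV[R]_dy) : {set 'I_dh} :=
  [set i | h i x y == 0]%SET.

Definition LICQ (R : realType) (dx dy dh : nat)
    (h : 'I_dh -> 'rV[R]_dx -> 'rV[R]_dy -> R) (x : 'rV[R]_dx)
    (y : 'rV[R]_dy) : bool :=
  free [seq grad_y (h i) x y | i <- enum (active h x y)].

Definition KKT (R : realType) (dx dy dh : nat)
    (f g : 'rV[R]_dx -> 'rV[R]_dy -> R)
    (h : 'I_dh -> 'rV[R]_dx -> 'rV[R]_dy -> R) (t : R) (x : 'rV[R]_dx)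
    (lam : 'rV[R]_dh) : Prop :=
  let y := ystar_t f g h t x in
  [/\ forall i, 0 <= lam ord0 i,
      t *: grad_y f x y + grad_y g x y +
        \sum_i lam ord0 i *: grad_y (h i) x y = 0 &
      forall i, lam ord0 i * h i x y = 0].

Definition lambda_t (R : realType) (dx dy dh : nat)
    (f g : 'rV[R]_dx -> 'rV[R]_dy -> R)
    (h : 'I_dh -> 'rV[R]_dx -> 'rV[R]_dy -> R) (t : R) (x : 'rV[R]_dx) :
    'rV[R]_dh :=
  get [set lam | KKT f g h t x lam].

Definition grad_bar (R : realType) (dx dy dh : nat)
    (h : 'I_dh -> 'rV[R]_dx -> 'rV[R]_dy -> R) (I : {set 'I_dh})
    (x : 'rV[R]_dx) (y : 'rV[R]_dy) : 'M[R]_(#|I|, dy) :=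
  \matrix_(k < #|I|) grad_y (h (enum_val k)) x y.

(* Main.v *)
Require Import Defs.
From HB Require Import structures.
From mathcomp Require Import all_boot all_order all_algebra.
From mathcomp Require Import all_classical all_reals all_analysis.
From mathcomp Require Import ring lra.
Import Order.TTheory GRing.Theory Num.Theory.
Import numFieldNormedType.Exports.
Local Open Scope classical_set_scope.
Local Open Scope ring_scope.

(** Write v_t(x) for the minimum of t f(x, .) + g(x, .) over the feasible set
    Y(x), attained at y_t(x) with multiplier lambda_t(x).  The inner maximum in
    Phi_delta only involves g, so Phi_delta = (v_delta - v_0) / delta
    (Phi_deltaE), and the envelope formula (value_diff) expresses its gradient by
    first derivatives of f, g, h at the two points y_0 and y_delta.  On the other
    side Phi is differentiated through y_0(x), whose derivative M solves, together
    with the derivative N of the multiplier, the linearized optimality system.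

    The difference quotients of y_t and lambda_t in t solve the same symmetric
    saddle-point system up to O(delta), with grad_y f in place of the mixed
    derivatives.  Pairing the two systems (gap_le) gives, for every direction xi,
      delta * <grad Phi - grad Phi_delta, xi>
        = <E, (xi, xi M)> + sum_i (xi N)_i <grad_y h_i, y_delta - y_0>.
    E is a second-order Taylor remainder along the segment from y_0 to y_delta
    (error_le), which stays feasible by convexity, and the second factor is of
    second order because h_i vanishes at both ends (constraint_defect).  As
    y_delta - y_0 and lambda_delta - lambda_0 are O(delta), the right-hand side is
    O(delta^2) with explicit constants.

    Differentiability of x |-> y_t(x) at the given point is obtained without
    solving the optimality system nearby: second derivatives are available at
    feasible points only.  Instead the linear prediction y_t + xi M is moved onto the active
    constraints by a contraction (constraint_correction); the corrected point is
    feasible and satisfies the optimality conditions up to o(|xi|) with the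
    nonnegative multiplier lambda_t + xi N, so strong convexity (near_stationary)
    puts it within o(|xi|) of the true minimizer (argmin_expand).

    The assumptions bound derivatives through Lipschitz constants on the feasible
    set.  Linear independence of the active gradients makes the points y_0 and
    y_delta limits of interior points of the joint feasible set
    (active_interior), which turns these Lipschitz constants, and strong convexity,
    into bounds on gradients and Hessians there (grad_bound, hess_bound,
    hess_coercive). *)

Set Implicit Arguments.
Unset Strict Implicit.
Unset Printing Implicit Defensive.

(** * Euclidean inner product and norm *)

Section Dot.
Variables (R : realType) (n : nat).
Implicit Types (u v w : 'rV[R]_n) (a : R).

Definition dot u v : R := \sum_i u ord0 i * v ord0 i.

Lemma dotC u v : dot u v = dot v u.
Proof. by apply: eq_bigr => i _; rewrite mulrC. Qed.

Lemma dotDl u v w : dot (u + v) w = dot u w + dot v w.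
Proof. by rewrite -big_split; apply: eq_bigr => i _; rewrite mxE mulrDl. Qed.

Lemma dotZl a u v : dot (a *: u) v = a * dot u v.
Proof. by rewrite mulr_sumr; apply: eq_bigr => i _; rewrite mxE mulrA. Qed.

Lemma dotNl u v : dot (- u) v = - dot u v.
Proof. by rewrite -scaleN1r dotZl mulN1r. Qed.

Lemma dotBl u v w : dot (u - v) w = dot u w - dot v w.
Proof. by rewrite dotDl dotNl. Qed.

Lemma dot0l v : dot 0 v = 0.
Proof. by rewrite -(scale0r 0) dotZl mul0r. Qed.

Lemma dotDr u v w : dot u (v + w) = dot u v + dot u w.
Proof. by rewrite dotC dotDl !(dotC _ u). Qed.

Lemma dotZr a u v : dot u (a *: v) = a * dot u v.
Proof. by rewrite dotC dotZl dotC. Qed.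

Lemma dotNr u v : dot u (- v) = - dot u v.
Proof. by rewrite dotC dotNl dotC. Qed.

Lemma dotBr u v w : dot u (v - w) = dot u v - dot u w.
Proof. by rewrite dotDr dotNr. Qed.

Lemma dot0r v : dot v 0 = 0.
Proof. by rewrite dotC dot0l. Qed.

Lemma dot_suml (J : finType) (F : J -> 'rV[R]_n) v :
  dot (\sum_j F j) v = \sum_j dot (F j) v.
Proof.
rewrite exchange_big /=; apply: eq_bigr => i _.
by rewrite summxE mulr_suml.
Qed.

Lemma dot_delta i v : dot (delta_mx ord0 i) v = v ord0 i.
Proof.
rewrite /dot (bigD1 i) //= mxE !eqxx mul1r big1 ?addr0 // => j jNi.
by rewrite mxE eqxx (negbTE jNi) mul0r.
Qed.

Lemma enorm_ge0 v : 0 <= enorm v.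
Proof. exact: sqrtr_ge0. Qed.

Lemma dotvv v : dot v v = enorm v ^+ 2.
Proof.
rewrite sqr_sqrtr; first by apply: eq_bigr => i _; rewrite expr2.
by apply: sumr_ge0 => i _; rewrite sqr_ge0.
Qed.

Lemma enorm0 : enorm (0 : 'rV[R]_n) = 0.
Proof. by apply/eqP; rewrite -sqrf_eq0 -dotvv dot0l. Qed.

Lemma enormZ a v : enorm (a *: v) = `|a| * enorm v.
Proof.
apply/eqP; rewrite -(eqrXn2 (ltn0Sn 1)) ?mulr_ge0 ?enorm_ge0 //.
by rewrite exprMn -!dotvv dotZl dotZr real_normK ?num_real // expr2 mulrA.
Qed.

Lemma enormN v : enorm (- v) = enorm v.
Proof. by rewrite -scaleN1r enormZ normrN1 mul1r. Qed.

Lemma enormB u v : enorm (u - v) = enorm (v - u).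
Proof. by rewrite -enormN opprB. Qed.

Lemma enorm_eq0 v : enorm v = 0 -> v = 0.
Proof.
move=> /eqP; rewrite -sqrf_eq0 -dotvv psumr_eq0 => [/allP v0|i _].
  apply/rowP => i; rewrite mxE; apply/eqP.
  by have := v0 i (mem_index_enum _); rewrite -expr2 sqrf_eq0.
by rewrite -expr2 sqr_ge0.
Qed.

Lemma dot_le u v : dot u v <= enorm u * enorm v.
Proof.
have [/enorm_eq0 ->|u0] := eqVneq (enorm u) 0; first by rewrite dot0l enorm0 mul0r.
have [/enorm_eq0 ->|v0] := eqVneq (enorm v) 0; first by rewrite dot0r enorm0 mulr0.
have ugt0 : 0 < enorm u by rewrite lt_def u0 enorm_ge0.
have vgt0 : 0 < enorm v by rewrite lt_def v0 enorm_ge0.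
have : 0 <= enorm (enorm u *: v - enorm v *: u) ^+ 2 by rewrite sqr_ge0.
rewrite -dotvv !(dotBl, dotBr, dotZl, dotZr) !dotvv (dotC v u) => H.
rewrite -(ler_pM2l ugt0) -(ler_pM2l vgt0); nra.
Qed.

Lemma dot_norm_le u v : `|dot u v| <= enorm u * enorm v.
Proof. by rewrite ler_norml dot_le lerNl -dotNl -(enormN u) dot_le. Qed.

Lemma enormD u v : enorm (u + v) <= enorm u + enorm v.
Proof.
rewrite -(@ler_pXn2r _ 2) ?nnegrE ?addr_ge0 ?enorm_ge0 //.
rewrite -dotvv !(dotDl, dotDr) !dotvv (dotC v u).
have := dot_le u v; nra.
Qed.

Lemma enormDB u v : enorm (u - v) <= enorm u + enorm v.
Proof. by rewrite -(enormN v) enormD. Qed.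

Lemma enorm_sum (J : finType) (P : pred J) (F : J -> 'rV[R]_n) :
  enorm (\sum_(j | P j) F j) <= \sum_(j | P j) enorm (F j).
Proof.
elim/big_ind2: _ => // [|a1 a2 b1 b2 ha hb]; first by rewrite enorm0.
by apply: (le_trans (enormD _ _)); rewrite lerD.
Qed.

Lemma coord_le_enorm v i : `|v ord0 i| <= enorm v.
Proof.
rewrite -(dot_delta i v) (le_trans (dot_norm_le _ _)) //.
rewrite -[leRHS]mul1r ler_wpM2r ?enorm_ge0 //.
rewrite -(@ler_pXn2r _ 2) ?nnegrE ?enorm_ge0 //.
by rewrite -dotvv dot_delta mxE !eqxx expr1n.
Qed.

Lemma norm_le_enorm v : `|v| <= enorm v.
Proof.
rewrite [leLHS]/Num.norm /= mx_normrE; apply/bigmax_leP; split; first exact: enorm_ge0.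
by move=> [i j] _ /=; rewrite (ord1 i) coord_le_enorm.
Qed.

Lemma coord_le_norm v i : `|v ord0 i| <= `|v|.
Proof.
rewrite [leRHS]/Num.norm /= mx_normrE; apply/bigmax_geP; right => /=.
by exists (ord0, i).
Qed.

Lemma enorm_le_coord v b : (forall i, `|v ord0 i| <= b) -> enorm v <= n%:R * b.
Proof.
move=> vb; case: (ltnP 0 n) => n0; last first.
  have -> : enorm v = 0.
    rewrite /enorm big1 ?sqrtr0 // => i _.
    by have := leq_trans (ltn_ord i) n0.
  by move: n0; rewrite leqn0 => /eqP ->; rewrite mul0r.
have b0 : 0 <= b by exact: le_trans (normr_ge0 _) (vb (Ordinal n0)).
rewrite -(@ler_pXn2r _ 2) ?nnegrE ?mulr_ge0 ?ler0n ?enorm_ge0 //.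
rewrite -dotvv (@le_trans _ _ (\sum_(i < n) b ^+ 2)) //.
  apply: ler_sum => i _; rewrite -expr2 -real_normK ?num_real //.
  by rewrite lerXn2r ?nnegrE ?vb.
rewrite sumr_const card_ord exprMn -[leLHS]mulr_natl ler_wpM2r ?sqr_ge0 //.
by rewrite expr2 ler_peMl ?ler0n // ler1n.
Qed.

Lemma enorm_le_norm v : enorm v <= n%:R * `|v|.
Proof. by apply: enorm_le_coord => i; exact: coord_le_norm. Qed.

(** The bound is tested at w = v. *)
Lemma enorm_le_dot v b : 0 <= b ->
  (forall w, dot v w <= b * enorm w) -> enorm v <= b.
Proof.
move=> b0 /(_ v); rewrite dotvv expr2.
have [->//|v0] := eqVneq (enorm v) 0.
by rewrite ler_pM2r // lt_def v0 enorm_ge0.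
Qed.
End Dot.

Section DotMx.
Variable R : realType.

Lemma dot_mulmx m n (A : 'M[R]_(m, n)) u v :
  dot (u *m A) v = dot u (v *m A^T).
Proof.
have dotE k (a b : 'rV[R]_k) : dot a b = (a *m b^T) ord0 ord0.
  by rewrite mxE; apply: eq_bigr => i _; rewrite mxE.
by rewrite !dotE trmx_mul trmxK mulmxA.
Qed.

Lemma mulmx_bounded m n (A : 'M[R]_(m, n)) :
  exists2 c, 0 <= c & forall v, enorm (v *m A) <= c * enorm v.
Proof.
exists (\sum_i enorm (row i A)); first by apply: sumr_ge0 => i _; exact: enorm_ge0.
move=> v; rewrite mulmx_sum_row (le_trans (enorm_sum _ _)) // mulr_suml.
by apply: ler_sum => i _; rewrite enormZ mulrC ler_wpM2l ?enorm_ge0 ?coord_le_enorm.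
Qed.

(** The supremum defining the operator norm is finite because every linear map is bounded. *)
Lemma opnormP m n (A : 'M[R]_(m, n)) v : enorm (v *m A) <= opnorm A * enorm v.
Proof.
have [/enorm_eq0 ->|v0] := eqVneq (enorm v) 0; first by rewrite mul0mx !enorm0 mulr0.
have vgt0 : 0 < enorm v by rewrite lt_def v0 enorm_ge0.
rewrite -ler_pdivrMr //.
have -> : enorm (v *m A) / enorm v = enorm (((enorm v)^-1 *: v) *m A).
  by rewrite -scalemxAl enormZ normfV ger0_norm ?enorm_ge0 // mulrC.
apply: sup_upper_bound; last first.
  exists ((enorm v)^-1 *: v) => //=.
  by rewrite enormZ normfV ger0_norm ?enorm_ge0 // mulVf.
split; first by exists (enorm ((0 : 'rV_m) *m A)); exists 0 => //=; rewrite enorm0.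
have [c c0 cA] := mulmx_bounded A; exists c => _ [w /= w1 <-].
by apply: (le_trans (cA w)); rewrite -[leRHS]mulr1 ler_wpM2l.
Qed.

Lemma dot_row_mx m n (a c : 'rV[R]_m) (b d : 'rV[R]_n) :
  dot (row_mx a b) (row_mx c d) = dot a c + dot b d.
Proof.
rewrite /dot big_split_ord /=; congr (_ + _); apply: eq_bigr => i _.
  by rewrite !row_mxEl.
by rewrite !row_mxEr.
Qed.

Lemma dot_sub m n (p q : 'rV[R]_(m + n)) :
  dot p q = dot (lsubmx p) (lsubmx q) + dot (rsubmx p) (rsubmx q).
Proof. by rewrite -dot_row_mx !hsubmxK. Qed.

Lemma enorm_row_mx0l m n (b : 'rV[R]_n) : enorm (row_mx (0 : 'rV[R]_m) b) = enorm b.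
Proof. by rewrite /enorm -!(eq_bigr _ (fun i _ => esym (expr2 _))) -/(dot _ _) dot_row_mx dot0l add0r. Qed.

Lemma enorm_row_mx0r m n (a : 'rV[R]_m) : enorm (row_mx a (0 : 'rV[R]_n)) = enorm a.
Proof. by rewrite /enorm -!(eq_bigr _ (fun i _ => esym (expr2 _))) -/(dot _ _) dot_row_mx dot0l addr0. Qed.

Lemma enorm_row_mx m n (a : 'rV[R]_m) (b : 'rV[R]_n) :
  enorm (row_mx a b) <= enorm a + enorm b.
Proof.
rewrite -(enorm_row_mx0l m b) -(enorm_row_mx0r n a).
by rewrite -[row_mx a b in leLHS](_ : row_mx a 0 + row_mx 0 b = _) ?enormD // add_row_mx addr0 add0r.
Qed.

Lemma enorm_rsubmx m n (p : 'rV[R]_(m + n)) : enorm (rsubmx p) <= enorm p.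
Proof.
rewrite -(@ler_pXn2r _ 2) ?nnegrE ?enorm_ge0 // -!dotvv (dot_sub p).
by rewrite lerDr dotvv sqr_ge0.
Qed.
End DotMx.

(** * Expansions, mean values and symmetry of second derivatives *)

Section Expand.
Variable R : realType.

(** The ambient topology comes from the sup norm; by equivalence of norms all
    expansions below can be phrased with the Euclidean one. *)
Lemma near0_enorm n (P : 'rV[R]_n -> Prop) :
  (\forall v \near (0 : 'rV[R]_n), P v) <->
  exists2 r : R, 0 < r & forall v, enorm v < r -> P v.
Proof.
split.
  move=> /nbhs_normP [r /= r0 rP]; exists r => // v vr; apply: rP.
  by rewrite /= sub0r normrN (le_lt_trans (norm_le_enorm v)).
move=> [r r0 rP]; apply/nbhs_normP; exists (r / (n%:R + 1)) => /=.
  by rewrite divr_gt0 // ltr_wpDl.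
move=> v; rewrite /= sub0r normrN => vr; apply: rP.
apply: (le_lt_trans (enorm_le_norm v)).
move: vr; rewrite ltr_pdivlMr ?ltr_wpDl // => vr.
by apply: le_lt_trans vr; rewrite mulrC ler_wpM2l // lerDl.
Qed.

Lemma near_shift0 n (p : 'rV[R]_n) (P : 'rV[R]_n -> Prop) :
  (\forall q \near p, P q) <-> (\forall v \near (0 : 'rV[R]_n), P (p + v)).
Proof.
rewrite (near_shift 0 p) /=; split; apply: filterS => v; by rewrite /= subr0 addrC.
Qed.

Lemma diff_expand_rV n m (F : 'rV[R]_n -> 'rV[R]_m) p : differentiable F p ->
  forall e : R, 0 < e -> \forall v \near (0 : 'rV[R]_n),
    enorm (F (p + v) - F p - v *m jacobian F p) <= e * enorm v.
Proof.
move=> dF e e0.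
have e1 : 0 < e / (m%:R + 1) by rewrite divr_gt0 // ltr_wpDl.
have /eqaddoP/(_ _ e1) := diff_locally dF.
apply: filterS => v /=; rewrite !fctE /= opprD addrA [v + p]addrC => Hv.
rewrite /jacobian mul_rV_lin1 (le_trans (enorm_le_norm _)) //.
apply: (@le_trans _ _ (m%:R * (e / (m%:R + 1) * `|v|))); first by rewrite ler_wpM2l.
apply: (@le_trans _ _ (e * `|v|)); last by rewrite ler_wpM2l ?norm_le_enorm // ltW.
rewrite mulrA ler_wpM2r // mulrCA ger_pMr //.
by rewrite ler_pdivrMr ?ltr_wpDl // mul1r lerDl.
Qed.

Lemma gradE n (F : 'rV[R]_n -> R) p v : differentiable F p ->
  'd F p v = dot (grad F p) v.
Proof.
move=> dF; rewrite [X in 'd F p X](row_sum_delta v) linear_sum /dot.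
by apply: eq_bigr => i _; rewrite linearZ /= mxE deriveE // mulrC.
Qed.

Lemma diff_expand n (F : 'rV[R]_n -> R) p : differentiable F p ->
  forall e : R, 0 < e -> \forall v \near (0 : 'rV[R]_n),
    `|F (p + v) - F p - dot (grad F p) v| <= e * enorm v.
Proof.
move=> dF e e0.
have /eqaddoP/(_ _ e0) := diff_locally dF.
apply: filterS => v /=; rewrite !fctE /= opprD addrA [v + p]addrC gradE // => Hv.
by rewrite (le_trans Hv) // ler_wpM2l ?norm_le_enorm // ltW.
Qed.

Lemma dot_is_linear n (a : 'rV[R]_n) : linear (dot a : 'rV[R]_n -> R).
Proof. by move=> k u v; rewrite dotDr dotZr. Qed.

Lemma dot_continuous n (a : 'rV[R]_n) : continuous (dot a).
Proof.
move=> p; apply/(@cvgrPdist_le _ _ _ (nbhs p)) => e e0; apply/near_shift0/near0_enorm.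
have k0 : 0 < enorm a + 1 by rewrite ltr_wpDl ?enorm_ge0.
exists (e / (enorm a + 1)); first by rewrite divr_gt0.
move=> v; rewrite ltr_pdivlMr // => ve.
rewrite -dotBr opprD addNKr dotNr normrN (le_trans (dot_norm_le _ _)) //.
by rewrite (le_trans _ (ltW ve)) // mulrC ler_wpM2l ?enorm_ge0 // lerDl.
Qed.

(** A linear approximation up to o(|v|) is the differential, by uniqueness of the latter. *)
Lemma expand_diff n (F : 'rV[R]_n -> R) (p a : 'rV[R]_n) :
  (forall e : R, 0 < e -> \forall v \near (0 : 'rV[R]_n),
    `|F (p + v) - F p - dot a v| <= e * enorm v) ->
  differentiable F p /\ grad F p = a.
Proof.
move=> H.
pose L : {linear 'rV[R]_n -> (R : normedModType R)} :=
  HB.pack (dot a) (GRing.isLinear.Build _ _ _ _ _ (dot_is_linear a)).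
have HF (e : R) : 0 < e ->
    \forall v \near (0 : 'rV[R]_n), `|F (v + p) - (F p + L v)| <= e * `|v|.
  move=> e0; have e1 : 0 < e / (n%:R + 1) by rewrite divr_gt0 // ltr_wpDl.
  apply: filterS (H _ e1) => v; rewrite opprD addrA [v + p]addrC => Hv.
  rewrite (le_trans Hv) // (@le_trans _ _ (e / (n%:R + 1) * (n%:R * `|v|))) //.
    by rewrite ler_wpM2l ?enorm_le_norm // ltW.
  rewrite mulrA ler_wpM2r // -mulrA ger_pMr // mulrC.
  by rewrite ler_pdivrMr ?ltr_wpDl // mul1r lerDl.
have ca : continuous L := @dot_continuous n a.
have dE : 'd F p = L :> (_ -> _) by apply: diff_unique ca _; apply/eqaddoP => e /HF.
have dF : differentiable F p.
  by apply/diff_locallyP; rewrite dE; split=> //; apply/eqaddoP => e /HF.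
split=> //; apply/rowP => i; rewrite mxE deriveE // dE.
by rewrite /= dotC dot_delta.
Qed.

(** Passing from increments v to increments s u of a fixed line turns expansions in several
    variables into the hypotheses of the one-dimensional mean value theorem. *)
Lemma along_line n (u : 'rV[R]_n) (A : 'rV[R]_n -> R) :
  (forall e : R, 0 < e -> \forall v \near (0 : 'rV[R]_n), A v <= e * enorm v) ->
  forall e : R, 0 < e -> exists2 r : R, 0 < r &
    forall s : R, `|s| < r -> A (s *: u) <= e * `|s|.
Proof.
move=> H e e0.
have k0 : 0 < enorm u + 1 by rewrite ltr_wpDl ?enorm_ge0.
have /H/near0_enorm [r r0 rP] : 0 < e / (enorm u + 1) by rewrite divr_gt0.
exists (r / (enorm u + 1)); first by rewrite divr_gt0.
move=> s; rewrite ltr_pdivlMr // => sr.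
apply: (le_trans (rP _ _)).
  by rewrite enormZ (le_lt_trans _ sr) // ler_wpM2l // lerDl.
rewrite enormZ mulrCA mulrC ler_wpM2r // -mulrA ger_pMr // mulrC.
by rewrite ler_pdivrMr // mul1r lerDl.
Qed.

Lemma expand_is_derive (phi : R -> R) (t a : R) :
  (forall e : R, 0 < e -> exists2 r : R, 0 < r &
     forall s : R, `|s| < r -> `|phi (t + s) - phi t - s * a| <= e * `|s|) ->
  is_derive t 1 phi a.
Proof.
move=> H.
have C : (h^-1 *: (phi (h *: 1 + t) - phi t)) @[h --> 0^'] --> a.
  apply/cvgrPdist_le => e e0; have [r r0 rP] := H _ e0.
  exists r => //= s; rewrite /ball_/= sub0r normrN => sr s0.
  rewrite distrC -(ler_pM2r (_ : 0 < `|s|)) ?normr_gt0 // (le_trans _ (rP _ sr)) //.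
  rewrite -normrM mulrBl /GRing.scale /= mulr1 mulrAC mulVf // mul1r.
  by rewrite [s + t]addrC [a * s]mulrC.
by apply: DeriveDef; [apply/cvg_ex; exists a | exact: cvg_lim C].
Qed.

(** Taking the derivative as an expansion lets the same statement serve functions, components of
    gradients and differences of translates. *)
Lemma mvt01 (phi dphi : R -> R) :
  (forall t : R, 0 <= t <= 1 -> forall e : R, 0 < e -> exists2 r : R, 0 < r &
     forall s : R, `|s| < r -> `|phi (t + s) - phi t - s * dphi t| <= e * `|s|) ->
  exists2 c : R, 0 <= c <= 1 & phi 1 - phi 0 = dphi c.
Proof.
move=> H.
have D (t : R) : t \in `[0, 1]%R -> is_derive t 1 phi (dphi t).
  by rewrite in_itv /= => /H; exact: expand_is_derive.
have cphi : {within `[0, 1], continuous phi}.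
  by apply: derivable_within_continuous => t /D [].
have D' (t : R) : t \in `]0, 1[%R -> is_derive t 1 phi (dphi t).
  by move=> /subset_itv_oo_cc; exact: D.
have [c c01 E] := @MVT_segment R phi dphi 0 1 ler01 D' cphi.
by exists c; [rewrite in_itv in c01 | rewrite E subr0 mulr1].
Qed.

Lemma mean_value n (F : 'rV[R]_n -> R) p u :
  (forall t : R, 0 <= t <= 1 -> differentiable F (p + t *: u)) ->
  exists2 c : R, 0 <= c <= 1 & F (p + u) - F p = dot (grad F (p + c *: u)) u.
Proof.
move=> D.
have [|c c01 E] := @mvt01 (fun t => F (p + t *: u)) (fun t => dot (grad F (p + t *: u)) u).
  move=> t /D dF e e0.
  have [r r0 rP] := along_line u (diff_expand dF) e0.
  by exists r => // s /rP; rewrite scalerDl addrA dotZr.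
by exists c; rewrite // -E scale1r scale0r addr0.
Qed.

Lemma mean_value_grad n (F : 'rV[R]_n -> R) p u w :
  (forall t : R, 0 <= t <= 1 -> differentiable (grad F) (p + t *: u)) ->
  exists2 c : R, 0 <= c <= 1 &
    dot (grad F (p + u) - grad F p) w = dot (u *m hess F (p + c *: u)) w.
Proof.
move=> D.
have [|c c01 E] := @mvt01 (fun t => dot (grad F (p + t *: u)) w)
    (fun t => dot (u *m hess F (p + t *: u)) w).
  move=> t /D dF e e0.
  have k0 : 0 < enorm w + 1 by rewrite ltr_wpDl ?enorm_ge0.
  have e1 : 0 < e / (enorm w + 1) by rewrite divr_gt0.
  have [r r0 rP] := along_line u (diff_expand_rV dF) e1.
  exists r => // s /rP; rewrite scalerDl addrA => H.
  rewrite -dotZl -!dotBl scalemxAl (le_trans (dot_norm_le _ _)) //.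
  rewrite (le_trans (ler_wpM2r (enorm_ge0 _) H)) //.
  rewrite mulrAC ler_wpM2r // -mulrA ger_pMr // mulrC.
  by rewrite ler_pdivrMr // mul1r lerDl.
by exists c; rewrite // -E scale1r scale0r addr0 dotBl.
Qed.

Lemma diff_grad_near n (F : 'rV[R]_n -> R) p :
  twice_differentiable_at F p ->
  exists2 r : R, 0 < r & forall v, enorm v < r -> differentiable F (p + v).
Proof. by move=> [/near_shift0 /near0_enorm]. Qed.

Lemma enorm_seg n (u v : 'rV[R]_n) (t r : R) : 0 <= t <= 1 ->
  enorm u < r -> enorm v < r -> enorm (u + t *: (v - u)) < r.
Proof.
move=> /andP[t0 t1] ur vr.
have -> : u + t *: (v - u) = (1 - t) *: u + t *: v.
  by rewrite scalerBr scalerBl scale1r addrA addrAC.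
rewrite (le_lt_trans (enormD _ _)) // !enormZ (ger0_norm t0) ger0_norm ?subr_ge0 //.
have [->|tn0] := eqVneq t 0; first by rewrite subr0 mul1r mul0r addr0.
have : t * enorm v < t * r by rewrite ltr_pM2l // lt_def tn0.
have : (1 - t) * enorm u <= (1 - t) * r by rewrite ler_wpM2l ?subr_ge0 // ltW.
lra.
Qed.

(** The gradient moves by O(r) on the ball of radius r around p, so by the mean value theorem
    F minus its linear part at p has Lipschitz constant O(r) there. *)
Lemma strict_diff n (F : 'rV[R]_n -> R) p : twice_differentiable_at F p ->
  forall e : R, 0 < e -> exists2 r : R, 0 < r & forall u v,
    enorm u < r -> enorm v < r ->
    `|F (p + v) - F (p + u) - dot (grad F p) (v - u)| <= e * enorm (v - u).
Proof.
move=> H e e0; have [r1 r10 D] := diff_grad_near H.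
have [c c0 cP] := mulmx_bounded (hess F p).
have /near0_enorm [r2 r20 r2P] := diff_expand_rV H.2 ltr01.
have k0 : 0 < c + 1 by rewrite ltr_wpDl.
exists (Num.min r1 (Num.min r2 (e / (c + 1)))).
  by rewrite !lt_min r10 r20 divr_gt0.
move=> u v; rewrite !lt_min => /and3P[u1 u2 u3] /and3P[v1 v2 v3].
have [|t t01] := @mean_value n F (p + u) (v - u).
  by move=> t t01; rewrite -addrA; apply: D; exact: enorm_seg.
rewrite -addrA (_ : u + (v - u) = v); last by rewrite addrC subrK.
move=> ->; rewrite -dotBl (le_trans (dot_norm_le _ _)) // ler_wpM2r ?enorm_ge0 //.
set w := u + t *: (v - u); rewrite -addrA -/w.
have w2 : enorm w < r2 by exact: enorm_seg.
have w3 : enorm w < e / (c + 1) by exact: enorm_seg.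
rewrite -(subrK (w *m jacobian (grad F) p) (_ - _)).
rewrite (le_trans (enormD _ _)) // (le_trans (lerD (r2P _ w2) (cP w))) //.
by rewrite -mulrDl mulrC addrC -ler_pdivlMr // ltW.
Qed.

(** Mean value theorem for t |-> F(p + s b + t s a) - F(p + t s a), whose derivative is expanded
    with the differential of the gradient at p only. *)
Lemma second_difference n (F : 'rV[R]_n -> R) p a b e :
  twice_differentiable_at F p -> 0 < e ->
  exists2 r : R, 0 < r & forall s : R, 0 < s < r ->
    `|F (p + (s *: a + s *: b)) - F (p + s *: a) - F (p + s *: b) + F p
      - s ^+ 2 * dot (b *m hess F p) a| <= s ^+ 2 * (2 * e * (enorm a + enorm b) ^+ 2).
Proof.
move=> H e0; have [r1 r10 D] := diff_grad_near H.
have /near0_enorm [r2 r20 r2P] := diff_expand_rV H.2 e0.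
set k := enorm a + enorm b.
have [a0 b0] : 0 <= enorm a /\ 0 <= enorm b by split; exact: enorm_ge0.
have k0 : 0 <= k by rewrite addr_ge0.
exists (Num.min r1 r2 / (k + 1)); first by rewrite divr_gt0 ?lt_min ?r10 // ltr_wpDl.
move=> s /andP[s0]; rewrite ltr_pdivlMr ?ltr_wpDl // => sk1.
have sk : s * k < Num.min r1 r2.
  by apply: le_lt_trans sk1; rewrite ler_wpM2l ?(ltW s0) // lerDl.
move: sk; rewrite lt_min => /andP[sk1' sk2'].
have small (t : R) : 0 <= t <= 1 -> enorm (t *: (s *: a)) <= s * enorm a.
  move=> /andP[t0 t1]; rewrite !enormZ (ger0_norm t0) (gtr0_norm s0).
  by rewrite ler_piMl // mulr_ge0 // ltW.
have w2P (t : R) : 0 <= t <= 1 -> enorm (t *: (s *: a)) <= s * k.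
  by move=> /small /le_trans -> //; rewrite ler_wpM2l ?(ltW s0) // lerDl.
have w1P (t : R) : 0 <= t <= 1 -> enorm (s *: b + t *: (s *: a)) <= s * k.
  move=> /small t1; rewrite (le_trans (enormD _ _)) // [k]addrC mulrDr lerD //.
  by rewrite enormZ (gtr0_norm s0).
have [|t t01 E] := @mvt01 (fun t => F (p + (s *: b + t *: (s *: a))) - F (p + t *: (s *: a)))
   (fun t => dot (grad F (p + (s *: b + t *: (s *: a))) - grad F (p + t *: (s *: a))) (s *: a)).
  move=> t t01 d d0; have d2 : 0 < d / 2 by rewrite divr_gt0.
  have dF1 := D _ (le_lt_trans (w1P _ t01) sk1').
  have dF2 := D _ (le_lt_trans (w2P _ t01) sk1').
  have [q1 q10 q1P] := along_line (s *: a) (diff_expand dF1) d2.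
  have [q2 q20 q2P] := along_line (s *: a) (diff_expand dF2) d2.
  exists (Num.min q1 q2); first by rewrite lt_min q10.
  move=> x; rewrite lt_min => /andP[/q1P + /q2P].
  rewrite !dotZr !dotBl !scalerDl -!addrA => H1 H2.
  rewrite [leRHS](_ : _ = d / 2 * `|x| + d / 2 * `|x|); last by rewrite -mulrDl -splitr.
  apply: le_trans (lerD H1 H2); apply: le_trans (ler_normB _ _).
  rewrite le_eqVlt; apply/orP; left; apply/eqP; congr (`|_|).
  ring.
move: E; rewrite scale1r scale0r !addr0 => E.
set w1 := s *: b + t *: (s *: a) in E; set w2 := t *: (s *: a) in E.
have F1 := le_trans (r2P _ (le_lt_trans (w1P _ t01) sk2')) (ler_wpM2l (ltW e0) (w1P _ t01)).
have F2 := le_trans (r2P _ (le_lt_trans (w2P _ t01) sk2')) (ler_wpM2l (ltW e0) (w2P _ t01)).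
rewrite -/w1 in F1; rewrite -/w2 in F2.
set e1 := grad F (p + w1) - _ - _ in F1; set e2 := grad F (p + w2) - _ - _ in F2.
have -> : F (p + (s *: a + s *: b)) - F (p + s *: a) - F (p + s *: b) + F p
      - s ^+ 2 * dot (b *m hess F p) a = dot (e1 - e2) (s *: a).
  have -> : e1 - e2 = grad F (p + w1) - grad F (p + w2) - s *: (b *m hess F p).
    have -> : s *: (b *m hess F p) = w1 *m hess F p - w2 *m hess F p.
      by rewrite -mulmxBl /w1 /w2 addrK scalemxAl.
    rewrite /e1 /e2 /hess.
    move: (grad F (p + w1)) (grad F (p + w2)) (grad F p) (w1 *m _) (w2 *m _) => *.
    by apply/rowP => ?; rewrite !mxE; ring.
  by rewrite dotBl -E !(dotZl, dotZr) [s *: b + _]addrC; ring.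
rewrite (le_trans (dot_norm_le _ _)) //.
have ee := le_trans (enormDB e1 e2) (lerD F1 F2).
rewrite (le_trans (ler_wpM2r (enorm_ge0 _) ee)) // enormZ (gtr0_norm s0).
have ak : enorm a <= k by rewrite lerDl.
rewrite [leLHS](_ : _ = s ^+ 2 * (2 * e * (k * enorm a))); last by ring.
rewrite ler_wpM2l ?sqr_ge0 // ler_wpM2l ?expr2 ?ler_wpM2l // mulr_ge0 // ltW //.
Qed.

(** Schwarz's theorem: the second difference is symmetric in its two increments. *)
Lemma hess_sym n (F : 'rV[R]_n -> R) p u v : twice_differentiable_at F p ->
  dot (u *m hess F p) v = dot (v *m hess F p) u.
Proof.
move=> H; apply/eqP; rewrite -subr_eq0 -normr_le0.
set D := _ - _; apply/ler_addgt0Pr => e e0; rewrite add0r.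
set k := (enorm u + enorm v) ^+ 2.
have k0 : 0 < 4 * (k + 1) by rewrite mulr_gt0 // ltr_wpDl ?sqr_ge0.
have e1 : 0 < e / (4 * (k + 1)) by rewrite divr_gt0.
have [r r0 rP] := second_difference u v H e1.
have [r' r'0 r'P] := second_difference v u H e1.
pose s := Num.min r r' / 2.
have s0 : 0 < s by rewrite divr_gt0 ?lt_min ?r0.
have [sr sr'] : s < r /\ s < r'.
  have : s < Num.min r r' by rewrite /s ltr_pdivrMr // ltr_pMr ?lt_min ?r0 // ltr1n.
  by rewrite lt_min => /andP.
have := rP s; rewrite s0 sr => /(_ isT) A1.
have := r'P s; rewrite s0 sr' => /(_ isT) A2.
have s2 : 0 < s ^+ 2 by rewrite exprn_gt0.
rewrite -(ler_pM2l s2) -[s ^+ 2 in leLHS]ger0_norm ?(ltW s2) // -normrM.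
move: A1 A2; rewrite [s *: v + _]addrC [enorm v + _]addrC -/k.
set X := F (_ + (_ + _)); set Y := F _; set Z := F (_ + s *: v).
rewrite (_ : X - Z - Y = X - Y - Z); last by rewrite addrAC.
set W := X - Y - Z + _ => A1 A2.
rewrite [_ * D](_ : _ = (W - s ^+ 2 * dot (v *m hess F p) u) - (W - s ^+ 2 * dot (u *m hess F p) v)); last first.
  by rewrite /D; ring.
rewrite (le_trans (ler_normB _ _)) // (le_trans (lerD A1 A2)) //.
rewrite -mulrDr ler_wpM2l ?(ltW s2) //.
have -> : 2 * (e / (4 * (k + 1))) * k + 2 * (e / (4 * (k + 1))) * k = e * (k / (k + 1)).
  have : k + 1 != 0 by rewrite gt_eqF // ltr_wpDl ?sqr_ge0.
  by move=> k1; field.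
rewrite ler_piMr ?(ltW e0) // ler_pdivrMr ?mul1r ?lerDl // ltr_wpDl ?sqr_ge0 //.
Qed.

End Expand.

(** * Convexity and interior points of the joint feasible set *)

(** The measure of smallness is a parameter, so that the lemma serves scalars, vectors and pairs of
    vectors. *)
Lemma common_radius (R : realType) (J : finType) (T : Type) (size : T -> R)
    (P : J -> T -> Prop) :
  (forall i, exists2 r : R, 0 < r & forall t, size t < r -> P i t) ->
  exists2 r : R, 0 < r & forall t, size t < r -> forall i, P i t.
Proof.
move=> H; have /choice [r rP] : forall i, exists r : R, 0 < r /\ forall t, size t < r -> P i t.
  by move=> i; have [r r0 rP] := H i; exists r.
exists (\big[Num.min/1]_i r i).
  by elim/big_ind: _ => // [a b a0 b0|i _]; [rewrite lt_min a0 | case: (rP i)].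
move=> t tr i; have [_ ] := rP i; apply; apply: lt_le_trans tr _.
by rewrite (bigD1 i) //= ge_min lexx.
Qed.

Lemma i01_of (R : realType) (s : R) : 0 <= s <= 1 -> exists t : {i01 R}, t%:num = s.
Proof. by move=> /andP[s0 s1]; exists (Itv01 s0 s1). Qed.

Lemma transfer_lower_bound (R : realType) (a b c d f g : R) :
  g <= b -> - c <= a - b -> c <= d -> d <= f -> g <= a + f.
Proof. lra. Qed.

Section Joint.
Variables (R : realType) (dx dy dh : nat).
Implicit Types (F : 'rV[R]_dx -> 'rV[R]_dy -> R) (x : 'rV[R]_dx) (y z v : 'rV[R]_dy).

Lemma joint_row F x y : joint F (row_mx x y) = F x y.
Proof. by rewrite /joint row_mxKl row_mxKr. Qed.

(** Both sides are limits of the same difference quotients. *)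
Lemma grad_yE F x y : grad_y F x y = rsubmx (grad (joint F) (row_mx x y)).
Proof.
apply/rowP => i; rewrite !mxE /derive; apply: (congr1 (fun k : R -> R => lim (k @ (0 : R)^'))); apply/funext => s /=.
have -> : delta_mx ord0 (rshift dx i) = row_mx 0 (delta_mx ord0 i) :> 'rV[R]_(dx + dy).
  apply/rowP => j; rewrite !mxE; case: splitP => k jk; rewrite !mxE.
    by rewrite -!val_eqE /= jk ltn_eqF ?andbF // (leq_trans (ltn_ord k)) ?leq_addr.
  by rewrite -!val_eqE /= jk eqn_add2l.
by rewrite scale_row_mx add_row_mx !joint_row scaler0 add0r.
Qed.

Lemma dot_grad_y F x y v :
  dot (grad_y F x y) v = dot (grad (joint F) (row_mx x y)) (row_mx 0 v).
Proof. by rewrite dot_sub row_mxKl row_mxKr dot0r add0r grad_yE. Qed.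

Lemma row_mx_line x y v (s : R) :
  row_mx x (y + s *: v) = row_mx x y + s *: row_mx 0 v.
Proof. by rewrite scale_row_mx add_row_mx scaler0 addr0. Qed.

Section Feasible.
Variable h : 'I_dh -> 'rV[R]_dx -> 'rV[R]_dy -> R.

Lemma feasible_row x y : feasible_joint h (row_mx x y) <-> feasible h x y.
Proof. by rewrite /feasible_joint /= row_mxKl row_mxKr. Qed.

Lemma feasible_segment x y z (s : R) :
  convex_set (feasible h x : set (convex_lmodType 'rV[R]_dy)) ->
  feasible h x y -> feasible h x z -> 0 <= s <= 1 -> feasible h x (y + s *: (z - y)).
Proof.
move=> cv fy fz /i01_of[t ts].
have := cv z y t; rewrite !inE => /(_ fz fy).
rewrite /conv /= /conv /= ts => H; suff -> : y + s *: (z - y) = s *: z + (1 - s) *: y by [].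
by rewrite scalerBr scalerBl scale1r addrCA.
Qed.

Lemma convex_function_strong0 F x :
  convex_function (feasible h x : set (convex_lmodType 'rV[R]_dy)) (F x) ->
  strongly_convex_on 0 (feasible h x) (F x).
Proof.
move=> cv y z s fy fz /i01_of[t ts].
have := cv t y z; rewrite !inE => /(_ fy fz).
by rewrite /conv /= /conv /= ts /unstable.onem !mul0r subr0.
Qed.

(** First-order form of mu-strong convexity; negative mu expresses weak convexity, which is what
    a Lipschitz gradient gives for f. *)
Definition first_order_convex (mu : R) F := forall x y z,
  feasible h x y -> feasible h x z ->
  F x y + dot (grad_y F x y) (z - y) + mu / 2 * enorm (z - y) ^+ 2 <= F x z.

(** Divide the convexity inequality at y + s (z - y) by s and let s tend to 0. *)
Lemma strong_first_order (mu : R) F :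
  (forall x, strongly_convex_on mu (feasible h x) (F x)) ->
  (forall p, feasible_joint h p -> differentiable (joint F) p) ->
  first_order_convex mu F.
Proof.
move=> sc dF x y z fy fz; set v := z - y.
have D := dF _ ((feasible_row x y).2 fy).
apply/ler_addgt0Pr => e e0.
have e2 : 0 < e / 2 by rewrite divr_gt0.
have [r r0 rP] := along_line (row_mx 0 v) (diff_expand D) e2.
set k := `|mu / 2| * enorm v ^+ 2 + 1.
have k0 : 0 < k by apply: ltr_wpDl => //; apply: mulr_ge0 => //; exact: sqr_ge0.
pose s := Num.min 1 (Num.min (r / 2) (e / 2 / k)).
have s0 : 0 < s by rewrite !lt_min ltr01 !divr_gt0.
have [s1 [sr sk]] : s <= 1 /\ s < r /\ s * k <= e / 2.
  rewrite -ler_pdivlMr // !ge_min !lexx ?orbT; split=> //; split=> //.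
  rewrite !gt_min; apply/orP; right; apply/orP; left.
  by rewrite ltr_pdivrMr // ltr_pMr ?ltr1n.
have := rP s; rewrite (gtr0_norm s0) => /(_ sr).
rewrite dotZr -dot_grad_y -row_mx_line !joint_row ler_norml => /andP[lb _].
have s01 : 0 <= s <= 1 by rewrite s1 (ltW s0).
have := sc x z y s fz fy s01.
rewrite (_ : s *: z + (1 - s) *: y = y + s *: v); last first.
  by rewrite /v scalerBr scalerBl scale1r addrCA.
rewrite -/v => ub.
have mk : mu / 2 * enorm v ^+ 2 * s <= e / 2.
  rewrite (le_trans _ sk) // mulrC ler_wpM2l ?(ltW s0) // /k.
  by rewrite ler_wpDr // ler_wpM2r ?sqr_ge0 // ler_norm.
rewrite -(ler_pM2l s0); have := ler_wpM2l (ltW s0) mk.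
move: (enorm v ^+ 2) (F x (y + s *: v)) (dot _ v) lb ub => N A a lb ub mk'; lra.
Qed.

(** Descent lemma: s |-> F(y + s v) + l / 2 s^2 |v|^2 - s <grad F(y), v> has nonnegative derivative.
    The factor 1/2 is what makes delta f + g strongly convex up to 2 l_{f,1} delta <= mu. *)
Lemma lipschitz_first_order (l : R) F :
  (forall x, convex_set (feasible h x : set (convex_lmodType 'rV[R]_dy))) ->
  (forall p, feasible_joint h p -> differentiable (joint F) p) ->
  lipschitz_for (@enorm R _) (feasible_joint h) l (grad (joint F)) ->
  first_order_convex (- l) F.
Proof.
move=> cv dF lip x y z fy fz; set v := z - y.
have fD (t : R) : 0 <= t <= 1 -> feasible_joint h (row_mx x y + t *: row_mx 0 v).
  by move=> t01; rewrite -row_mx_line; apply/feasible_row/feasible_segment.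
set a := dot (grad_y F x y) v; set N := enorm v ^+ 2.
have N0 : 0 <= N by exact: sqr_ge0.
have [|t t01 E] := @mvt01 R (fun s => joint F (row_mx x y + s *: row_mx 0 v) + l / 2 * s ^+ 2 * N - s * a)
  (fun s => dot (grad (joint F) (row_mx x y + s *: row_mx 0 v)) (row_mx 0 v) + l * s * N - a).
  move=> t t01 e e0; have e2 : 0 < e / 2 by rewrite divr_gt0.
  have [r r0 rP] := along_line (row_mx 0 v) (diff_expand (dF _ (fD _ t01))) e2.
  set k := `|l / 2 * N| + 1.
  have k0 : 0 < k by rewrite ltr_wpDl.
  exists (Num.min r (e / 2 / k)); first by rewrite lt_min r0 !divr_gt0.
  move=> s; rewrite lt_min ltr_pdivlMr // => /andP[/rP + sk].
  rewrite dotZr [in X in _ -> X]scalerDl [in X in _ -> X]addrA => H.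
  set X := joint F _; set Y := joint F _; set d := dot _ _ in H *.
  rewrite [X in `|X|](_ : _ = (X - Y - s * d) + s * (s * (l / 2 * N))); last by field.
  rewrite (le_trans (ler_normD _ _)) // [e in leRHS]splitr mulrDl lerD //.
  rewrite !(normrM s) mulrC ler_wpM2r //; apply: le_trans (ltW sk).
  by rewrite ler_wpM2l // lerDl.
move: E; rewrite scale1r scale0r addr0 add_row_mx addr0 (_ : y + v = z) ?joint_row; last by rewrite /v addrC subrK.
rewrite expr1n expr0n /= !mulr1 mulr0 !mul1r !mul0r addr0 subr0 => E.
have H : - (l * t * N) <= dot (grad (joint F) (row_mx x y + t *: row_mx 0 v)) (row_mx 0 v) - a.
  rewrite /a dot_grad_y -dotBl lerNl -dotNl opprB (le_trans (dot_le _ _)) //.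
  rewrite enorm_row_mx0l.
  have := lip _ _ ((feasible_row x y).2 fy) (fD _ t01).
  rewrite opprD addNKr enormN enormZ enorm_row_mx0l ger0_norm; last by case/andP: t01.
  by move=> /(ler_wpM2r (enorm_ge0 v)); rewrite /N expr2 !mulrA.
move: E H => /eqP; rewrite subr_eq => /eqP E H; lra.
Qed.

(** The assumptions speak of feasible points only.  At an interior point they control increments in
    every direction, and continuity of the derivatives carries the resulting bounds to limits of
    interior points. *)
Definition interior_limit (p : 'rV[R]_(dx + dy)) := forall r : R, 0 < r ->
  exists w, [/\ enorm w < r, feasible_joint h (p + w) &
    exists2 r' : R, 0 < r' & forall w', enorm w' < r' -> feasible_joint h (p + w + w')].

(** Active constraints decrease to first order along v and inactive ones stay negative by
    continuity. *)
Lemma feasible_direction x y v (u := row_mx 0 v : 'rV[R]_(dx + dy)) :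
  feasible h x y ->
  (forall i, differentiable (joint (h i)) (row_mx x y)) ->
  (forall i, i \in active h x y -> dot (grad_y (h i) x y) v < 0) ->
  exists2 r : R, 0 < r & forall s : R, 0 < s < r -> forall i,
    joint (h i) (row_mx x y + s *: u) < 0.
Proof.
move=> fy dfh hv; set p := row_mx x y.
suff [r r0 rP] : exists2 r : R, 0 < r & forall s : R, `|s| < r -> forall i,
    0 < s -> joint (h i) (p + s *: u) < 0.
  by exists r => // s /andP[s0 sr] i; apply: rP => //; rewrite gtr0_norm.
apply: common_radius => i.
have dhi := dfh i.
have [hi0|hiN0] := boolP (i \in active h x y).
  have a0 := hv i hi0; set a := dot _ _ in a0.
  have e0 : 0 < - a / 2 by rewrite divr_gt0 // oppr_gt0.
  have [q q0 qP] := along_line u (diff_expand dhi) e0.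
  exists q => // s /qP + s0; rewrite dotZr -dot_grad_y -/a joint_row (gtr0_norm s0).
  move: hi0; rewrite inE => /eqP ->; rewrite subr0 ler_norml => /andP[_].
  have : s * a < 0 by rewrite pmulr_rlt0.
  lra.
have hi1 : h i x y < 0 by rewrite lt_neqAle fy andbT; move: hiN0; rewrite inE.
set a := dot (grad (joint (h i)) p) u.
have [q q0 qP] := along_line u (diff_expand dhi) (@ltr01 R).
have k0 : 0 < 1 + `|a| by rewrite ltr_pwDl.
exists (Num.min q (- h i x y / (1 + `|a|))).
  by rewrite lt_min q0 divr_gt0 // oppr_gt0.
move=> s; rewrite lt_min ltr_pdivlMr // => /andP[/qP + sk] s0.
rewrite dotZr -/a joint_row mul1r ler_norml => /andP[_].
move: sk; rewrite (gtr0_norm s0) => sk.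
have : s * a <= s * `|a| by rewrite ler_wpM2l ?(ltW s0) // ler_norm.
lra.
Qed.

(** All constraints are strictly negative at the points p + s (0, v) for small s > 0, and they are
    continuous there since they are differentiable near p. *)
Lemma interior_limitP x y v :
  feasible h x y ->
  (forall i, twice_differentiable_at (joint (h i)) (row_mx x y)) ->
  (forall i, i \in active h x y -> dot (grad_y (h i) x y) v < 0) ->
  interior_limit (row_mx x y).
Proof.
move=> fy dh2 hv r r0; set p := row_mx x y; set u : 'rV[R]_(dx + dy) := row_mx 0 v.
have [r1 r10 r1P] := feasible_direction fy (fun i => nbhs_singleton (dh2 i).1) hv.
have [r2 r20 r2P] : exists2 r : R, 0 < r & forall w, enorm w < r -> forall i,
    differentiable (joint (h i)) (p + w).
  by apply: common_radius => i; exact: diff_grad_near.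
have k0 : 0 < enorm u + 1 by rewrite ltr_wpDl ?enorm_ge0.
pose s := Num.min r1 (Num.min r2 r / (enorm u + 1)) / 2.
have m0 : 0 < Num.min r1 (Num.min r2 r / (enorm u + 1)).
  by rewrite lt_min r10 divr_gt0 // lt_min r20.
have s0 : 0 < s by rewrite divr_gt0.
have : s < Num.min r1 (Num.min r2 r / (enorm u + 1)) by rewrite ltr_pdivrMr // ltr_pMr // ltr1n.
rewrite lt_min ltr_pdivlMr // => /andP[sr1 sk].
have : enorm (s *: u) < Num.min r2 r.
  rewrite enormZ (gtr0_norm s0) // (le_lt_trans _ sk) // ler_wpM2l ?(ltW s0) //.
  by rewrite lerDl.
rewrite lt_min => /andP[ur2 ur].
have neg i : joint (h i) (p + s *: u) < 0 by apply: r1P; rewrite s0.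
exists (s *: u); split => //; first by move=> i; exact/ltW/neg.
have [q q0 qP] : exists2 r : R, 0 < r & forall w, enorm w < r -> forall i,
    joint (h i) (p + s *: u + w) <= 0.
  apply: common_radius => i.
  have /near0_enorm [q q0 qP] := diff_expand (r2P _ ur2 i) (@ltr01 R).
  set b := grad _ _ in qP; have k1 : 0 < 1 + enorm b by rewrite ltr_pwDl ?enorm_ge0.
  exists (Num.min q (- joint (h i) (p + s *: u) / (1 + enorm b))).
    by rewrite lt_min q0 divr_gt0 // oppr_gt0.
  move=> w; rewrite lt_min ltr_pdivlMr // => /andP[/qP + wk].
  rewrite mul1r ler_norml => /andP[_].
  have := dot_le b w; lra.
by exists q => // w /qP H i; exact: H.
Qed.

Section Bounds.
Variables (F : 'rV[R]_dx -> 'rV[R]_dy -> R) (l0 l1 l2 : R) (p : 'rV[R]_(dx + dy)).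
Hypothesis l0_ge0 : 0 <= l0.
Hypothesis l1_ge0 : 0 <= l1.
Hypothesis l2_ge0 : 0 <= l2.
Hypothesis twF : forall q, feasible_joint h q -> twice_differentiable_at (joint F) q.
Hypothesis lipF : lipschitz_for (@Num.norm R R) (feasible_joint h) l0 (joint F).
Hypothesis lipG : lipschitz_for (@enorm R _) (feasible_joint h) l1 (grad (joint F)).
Hypothesis lipH : lipschitz_for (@opnorm R _ _) (feasible_joint h) l2 (hess (joint F)).
Hypothesis Dp : feasible_joint h p.
Hypothesis ip : interior_limit p.

Lemma interior_step (q v : 'rV[R]_(dx + dy)) (r r' : R) : 0 < r -> 0 < r' ->
  (forall w', enorm w' < r' -> feasible_joint h (q + w')) ->
  exists s : R, [/\ 0 < s, s < r & feasible_joint h (q + s *: v)].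
Proof.
move=> r0 r'0 r'P.
have k1 : 0 < enorm v + 1 by rewrite ltr_wpDl ?enorm_ge0.
pose s := Num.min r (r' / (enorm v + 1)) / 2.
have s0 : 0 < s by rewrite divr_gt0 // lt_min r0 divr_gt0.
have : s < Num.min r (r' / (enorm v + 1)).
  by rewrite ltr_pdivrMr // ltr_pMr ?ltr1n // lt_min r0 divr_gt0.
rewrite lt_min ltr_pdivlMr // => /andP[sr sk]; exists s; split=> //.
apply: r'P; rewrite enormZ (gtr0_norm s0) // (le_lt_trans _ sk) //.
by rewrite ler_wpM2l ?(ltW s0) // lerDl.
Qed.

Lemma interior_close (k e : R) : 0 <= k -> 0 < e -> exists w,
  [/\ k * enorm w <= e, feasible_joint h (p + w) & exists2 r' : R, 0 < r' &
     forall w', enorm w' < r' -> feasible_joint h (p + w + w')].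
Proof.
move=> k0 e0; have k1 : 0 < k + 1 by rewrite ltr_wpDl.
have [w [wr Dw H]] := ip (divr_gt0 e0 k1); exists w; split=> //.
rewrite ltr_pdivlMr // in wr; rewrite (le_trans _ (ltW wr)) // mulrC.
by rewrite ler_wpM2l ?enorm_ge0 // lerDl.
Qed.

Lemma grad_bound : enorm (grad (joint F) p) <= l0.
Proof.
apply/ler_addgt0Pr => e e0.
have [w [wr Dw [r' r'0 r'P]]] := interior_close l1_ge0 e0.
set q := p + w in Dw r'P.
have Gq : enorm (grad (joint F) q) <= l0.
  apply: enorm_le_dot => // v; apply/ler_addgt0Pr => d d0.
  have [r r0 rP] := along_line v (diff_expand (nbhs_singleton (twF Dw).1)) d0.
  have [s [s0 sr Ds]] := interior_step v r0 r'0 r'P.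
  have := lipF Ds Dw; rewrite [q + _ - q]addrC addKr enormZ.
  have := rP s; rewrite (gtr0_norm s0) => /(_ sr); rewrite dotZr !ler_norml.
  move=> /andP[A _] /andP[_ B]; rewrite -(ler_pM2l s0); lra.
have := lipG Dp Dw; rewrite opprD addNKr enormN => H.
have := enormD (grad (joint F) p - grad (joint F) q) (grad (joint F) q).
rewrite subrK; lra.
Qed.

Lemma hess_bound (v : 'rV[R]_(dx + dy)) : enorm (v *m hess (joint F) p) <= l1 * enorm v.
Proof.
apply/ler_addgt0Pr => e e0.
have k0 : 0 <= l2 * enorm v by rewrite mulr_ge0 ?enorm_ge0.
have [w [wr Dw [r' r'0 r'P]]] := interior_close k0 e0.
set q := p + w in Dw r'P.
have Hq : enorm (v *m hess (joint F) q) <= l1 * enorm v.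
  apply/ler_addgt0Pr => d d0.
  have [r r0 rP] := along_line v (diff_expand_rV (twF Dw).2) d0.
  have [s [s0 sr Ds]] := interior_step v r0 r'0 r'P.
  have := lipG Ds Dw; rewrite [q + _ - q]addrC addKr enormZ (gtr0_norm s0) //.
  have := rP s; rewrite (gtr0_norm s0) => /(_ sr); set g1 := grad _ _; set g2 := grad _ _.
  move=> A B; rewrite -(ler_pM2l s0) -[s in leLHS]gtr0_norm // -enormZ scalemxAl.
  have := enormDB (g1 - g2) (g1 - g2 - (s *: v) *m jacobian (grad (joint F)) q).
  rewrite opprB addrCA subrr addr0; rewrite /hess; lra.
have := le_trans (opnormP (hess (joint F) p - hess (joint F) q) v)
  (ler_wpM2r (enorm_ge0 v) (lipH Dp Dw)).
rewrite opprD addNKr enormN mulmxBr => H.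
have := enormD (v *m hess (joint F) p - v *m hess (joint F) q) (v *m hess (joint F) q).
by rewrite subrK => /le_trans -> //; rewrite addrC lerD // (le_trans H) // mulrAC.
Qed.

(** Adding the two first-order inequalities between q and q + s (0, v) bounds the increment of the
    gradient from below; s tends to 0 and then q to p. *)
Lemma hess_coercive m v : first_order_convex m F ->
  m * enorm v ^+ 2 <= dot (row_mx 0 v *m hess (joint F) p) (row_mx 0 v).
Proof.
move=> foc; set u : 'rV[R]_(dx + dy) := row_mx 0 v.
have uE : enorm u = enorm v by exact: enorm_row_mx0l.
apply/ler_addgt0Pr => e e0.
have k0 : 0 <= l2 * enorm v * enorm v by rewrite !mulr_ge0 ?enorm_ge0.
have [w [wr Dw [r' r'0 r'P]]] := interior_close k0 e0.
set q := p + w in Dw r'P.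
have Hq : m * enorm v ^+ 2 <= dot (u *m hess (joint F) q) u.
  apply/ler_addgt0Pr => d d0.
  have k1 : 0 < enorm v + 1 by rewrite ltr_wpDl ?enorm_ge0.
  have [r r0 rP] := along_line u (diff_expand_rV (twF Dw).2) (divr_gt0 d0 k1).
  have [s [s0 sr Ds]] := interior_step u r0 r'0 r'P.
  have := rP s; rewrite (gtr0_norm s0) => /(_ sr) A.
  have qE : q = row_mx (lsubmx q) (rsubmx q) by rewrite hsubmxK.
  set x := lsubmx q in qE; set y := rsubmx q in qE.
  have qsE : q + s *: u = row_mx x (y + s *: v) by rewrite row_mx_line -qE.
  have fy : feasible h x y by apply/feasible_row; rewrite -qE.
  have fz : feasible h x (y + s *: v) by apply/feasible_row; rewrite -qsE.
  have := foc _ _ _ fy fz; have := foc _ _ _ fz fy.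
  rewrite opprD addNKr [y + _ - y]addrC addKr dotNr enormN !dotZr !enormZ (gtr0_norm s0).
  rewrite !dot_grad_y -/u -qsE -qE => C1 C2.
  have B : m * s * enorm v ^+ 2 <= dot (grad (joint F) (q + s *: u) - grad (joint F) q) u.
    rewrite dotBl -(ler_pM2l s0); lra.
  have C := le_trans (dot_le _ u) (ler_wpM2r (enorm_ge0 u) A).
  have dv : d / (enorm v + 1) * s * enorm u <= d * s.
    rewrite uE mulrAC ler_wpM2r ?(ltW s0) // -mulrA ler_piMr ?(ltW d0) //.
    by rewrite mulrC ler_pdivrMr // mul1r lerDl.
  move: C; rewrite dotBl -scalemxAl dotZl -/(hess (joint F) q) => C.
  rewrite -(ler_pM2l s0); lra.
have := le_trans (opnormP (hess (joint F) p - hess (joint F) q) u)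
  (ler_wpM2r (enorm_ge0 u) (lipH Dp Dw)).
rewrite opprD addNKr enormN mulmxBr => H.
have := dot_norm_le (u *m hess (joint F) p - u *m hess (joint F) q) u.
rewrite ler_norml => /andP[+ _]; rewrite dotBl => K.
apply: (transfer_lower_bound Hq K (ler_wpM2r (enorm_ge0 u) H)).
rewrite uE; apply: le_trans wr. by rewrite (mulrAC l2) [leLHS]mulrAC.
Qed.
End Bounds.

End Feasible.
End Joint.

(** * Singular values and saddle-point systems *)

Section LinAlg.
Variable R : realType.

Lemma lipschitz_continuous n (F : 'rV[R]_n -> R) c :
  (forall p q, `|F p - F q| <= c * enorm (p - q)) -> continuous F.
Proof.
move=> H p; apply/(@cvgrPdist_le _ _ _ (nbhs p)) => e e0; apply/near_shift0/near0_enorm.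
have k0 : 0 < `|c| + 1 by rewrite ltr_wpDl.
exists (e / (`|c| + 1)); first by rewrite divr_gt0.
move=> v; rewrite ltr_pdivlMr // => ve.
apply: (le_trans (H _ _)); rewrite opprD addNKr enormN.
rewrite (le_trans _ (ltW ve)) // mulrC ler_wpM2l ?enorm_ge0 //.
by rewrite (le_trans (ler_norm _)) // lerDl.
Qed.

Lemma enorm_dist n (u v : 'rV[R]_n) : `|enorm u - enorm v| <= enorm (u - v).
Proof.
have := enormD (u - v) v; have := enormD (v - u) u.
rewrite !subrK (enormB v u) ler_norml => A B; apply/andP; split; lra.
Qed.

Lemma enorm_continuous n : continuous (@enorm R n).
Proof.
apply: (@lipschitz_continuous _ _ 1) => p q; rewrite mul1r; exact: enorm_dist.
Qed.

Lemma enorm_mulmx_continuous m n (B : 'M[R]_(m, n)) :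
  continuous (fun w : 'rV[R]_m => enorm (w *m B)).
Proof.
have [c c0 cP] := mulmx_bounded B; apply: (@lipschitz_continuous _ _ c) => p q.
by rewrite (le_trans (enorm_dist _ _)) // -mulmxBl.
Qed.

(** First-order condition at the minimum of a quadratic function of one real variable. *)
Lemma linear_coef0 (a b : R) : (forall s : R, 0 <= s * a + s ^+ 2 * b) -> a = 0.
Proof.
move=> H; apply/eqP; rewrite -normr_le0; apply/ler_addgt0Pr => e e0; rewrite add0r.
have k0 : 0 < `|b| + 1 by rewrite ltr_wpDl.
set t := e / (`|b| + 1); have t0 : 0 < t by rewrite divr_gt0.
have tb : t * b <= e.
  rewrite /t mulrAC -mulrA ler_piMr ?(ltW e0) // ler_pdivrMr // mul1r.
  by rewrite (le_trans (ler_norm _)) // lerDl.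
have := H t; have := H (- t); rewrite sqrrN => A B.
rewrite ler_norml; apply/andP; split; rewrite -(ler_pM2l t0); nra.
Qed.

(** Rayleigh quotient: a minimizer of |w B| on the unit sphere is an eigenvector of B B^T, so the
    square of the minimum is an eigenvalue. *)
Lemma singular_lower m n (B : 'M[R]_(m, n)) (s0 : R) : (m <= n)%N -> 0 < s0 ->
  (forall s, singular_value B s -> s0 <= s) ->
  forall w, s0 * enorm w <= enorm (w *m B).
Proof.
move=> mn s00 H.
have [w00|/existsNP [w1 /eqP w1N']] := pselect (forall w : 'rV[R]_m, w = 0).
  by move=> w; rewrite (w00 w) mul0mx !enorm0 mulr0.
have w1N : enorm w1 != 0 by apply: contra w1N' => /eqP/enorm_eq0 ->.
pose S : set 'rV[R]_m := [set w | enorm w = 1].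
have S0 : S !=set0.
  exists ((enorm w1)^-1 *: w1); rewrite /S /= enormZ normfV ger0_norm ?enorm_ge0 //.
  by rewrite mulVf.
have Sc : compact S.
  apply: bounded_closed_compact.
    exists 1; split; first exact: num_real.
    by move=> x x1 w /= w1'; rewrite (le_trans (norm_le_enorm w)) // w1' ltW.
  by apply: (@closed_comp _ _ (@enorm R m) [set 1]) => [w _|]; [exact: enorm_continuous | exact: closed_eq].
have [w0 Sw0 w0min] := EVT_min_rV S0 Sc (continuous_subspaceT (@enorm_mulmx_continuous _ _ B)).
rewrite inE /S /= in Sw0.
set k := enorm (w0 *m B) in w0min; have k0 : 0 <= k by exact: enorm_ge0.
have kP w : k * enorm w <= enorm (w *m B).
  have [/enorm_eq0 ->|wN] := eqVneq (enorm w) 0; first by rewrite mul0mx !enorm0 mulr0.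
  have wp : 0 < enorm w by rewrite lt_def wN enorm_ge0.
  have := w0min ((enorm w)^-1 *: w); rewrite inE /S /= -scalemxAl !enormZ normfV (gtr0_norm wp).
  by rewrite mulVf // => /(_ erefl); rewrite ler_pdivlMl // mulrC.
suff sk : s0 <= k by move=> w; rewrite (le_trans _ (kP w)) // ler_wpM2r ?enorm_ge0.
apply: H; split=> //; rewrite mn; apply/eigenvalueP; exists w0; last first.
  by apply/eqP => w00; move: Sw0; rewrite w00 enorm0 => /eqP; rewrite eq_sym oner_eq0.
apply/eqP; rewrite -subr_eq0; apply/eqP; set d := _ - _.
suff : enorm d ^+ 2 = 0 by move=> /eqP; rewrite sqrf_eq0 => /eqP /enorm_eq0.
rewrite -dotvv.
have dd v : dot d v = dot (w0 *m B) (v *m B) - k ^+ 2 * dot w0 v.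
  by rewrite /d dotBl dotZl mulmxA (dot_mulmx B^T) trmxK.
clearbody d.
have E : forall s, 0 <= s * (2 * dot d d) + s ^+ 2 * (enorm (d *m B) ^+ 2 - k ^+ 2 * enorm d ^+ 2).
  move=> s; have : (k * enorm (w0 + s *: d)) ^+ 2 <= enorm ((w0 + s *: d) *m B) ^+ 2.
    by rewrite ler_pXn2r ?nnegrE ?mulr_ge0 ?enorm_ge0.
  rewrite exprMn -(dotvv (w0 + _)) -(dotvv (_ *m B)) mulmxDl -scalemxAl !(dotDl, dotDr, dotZl, dotZr).
  rewrite (dotC (d *m B) (w0 *m B)) (dotC d w0) !(dotvv w0) !(dotvv d) !(dotvv (_ *m B)) Sw0 -/k.
  have := dd d; rewrite dotvv.
  move: (enorm d) (enorm (d *m B)) (dot (w0 *m B) (d *m B)) (dot w0 d) => e1 e2 e3 e4; nra.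
by have /eqP := linear_coef0 E; rewrite mulf_eq0 pnatr_eq0 => /eqP.
Qed.

(** The system is square, and its kernel is trivial: pairing the first equation of a kernel element
    (u, w) with u gives u = 0 by coercivity, then independence gives w = 0.  Multipliers are kept as
    vectors indexed by all constraints; the block P below forces those outside I to vanish. *)
Lemma saddle_solve dy dh (A : 'M[R]_dy) (b : 'I_dh -> 'rV[R]_dy) (I : {set 'I_dh}) (m : R) :
  0 < m -> (forall u, m * enorm u ^+ 2 <= dot (u *m A) u) ->
  (forall w : 'rV[R]_dh, (forall i, i \notin I -> w ord0 i = 0) ->
     \sum_i w ord0 i *: b i = 0 -> w = 0) ->
  exists (M : 'M[R]_(dy + dh, dy)) (N : 'M[R]_(dy + dh, dh)),
  forall (a : 'rV[R]_dy) (r : 'rV[R]_dh), (forall i, i \notin I -> r ord0 i = 0) ->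
  let u := row_mx a r *m M in let w := row_mx a r *m N in
  [/\ u *m A + \sum_i w ord0 i *: b i = a,
      forall i, i \in I -> dot (b i) u = r ord0 i &
      forall i, i \notin I -> w ord0 i = 0].
Proof.
move=> m0 Acoer indep.
pose B : 'M[R]_(dh, dy) := \matrix_i (if i \in I then b i else 0).
pose P : 'M[R]_dh := diag_mx (\row_i (i \notin I)%:R).
pose K := block_mx A B^T B P.
have PE (w : 'rV[R]_dh) i : (w *m P) ord0 i = w ord0 i * (i \notin I)%:R.
  by rewrite mul_mx_diag !mxE.
have BE (u : 'rV[R]_dy) i : (u *m B^T) ord0 i = if i \in I then dot (b i) u else 0.
  rewrite mxE; case: ifP => iI; last by rewrite big1 // => j _; rewrite !mxE iI mxE mulr0.
  by apply: eq_bigr => j _; rewrite !mxE iI mulrC.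
have wBE (w : 'rV[R]_dh) : (forall i, i \notin I -> w ord0 i = 0) ->
    w *m B = \sum_i w ord0 i *: b i.
  move=> w0; rewrite mulmx_sum_row; apply: eq_bigr => i _.
  by rewrite rowK; case: ifPn => // /w0 ->; rewrite !scale0r.
have KE u w : row_mx u w *m K = row_mx (u *m A + w *m B) (u *m B^T + w *m P).
  by rewrite mul_row_block.
have split_ a r u w : row_mx u w *m K = row_mx a r -> (forall i, i \notin I -> r ord0 i = 0) ->
  [/\ u *m A + \sum_i w ord0 i *: b i = a,
      forall i, i \in I -> dot (b i) u = r ord0 i &
      forall i, i \notin I -> w ord0 i = 0].
  move=> + r0; rewrite KE => /eq_row_mx [E1 E2].
  have w0 i : i \notin I -> w ord0 i = 0.
    move=> iI; have := congr1 (fun M : 'rV[R]_dh => M ord0 i) E2.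
    by rewrite mxE BE PE (negbTE iI) /= mulr1 add0r r0.
  split=> //; first by rewrite -E1 wBE.
  move=> i iI; rewrite -E2 mxE BE PE iI /= mulr0 addr0.
  by [].
have Ku : K \in unitmx.
  rewrite -row_free_unit; apply: inj_row_free => v; rewrite -[v]hsubmxK => E.
  have /split_ : row_mx (lsubmx v) (rsubmx v) *m K = row_mx 0 0 by rewrite E row_mx0.
  move=> [i _|]; first by rewrite mxE.
  set u := lsubmx v; set w := rsubmx v => E1 E2 E3.
  have u0 : u = 0.
    apply: enorm_eq0; apply/eqP; rewrite -sqrf_eq0 -(mulrI_eq0 _ (mulfI (lt0r_neq0 m0))).
    apply/eqP/le_anti; rewrite mulr_ge0 ?sqr_ge0 ?(ltW m0) // andbT.
    rewrite (le_trans (Acoer u)) //.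
    have -> : u *m A = - \sum_i w ord0 i *: b i by apply/eqP; rewrite -addr_eq0 E1.
    rewrite dotNl dot_suml oppr_le0 sumr_ge0 // => i _; rewrite dotZl.
    by have [iI|/E3 ->] := boolP (i \in I); rewrite ?mul0r // E2 // [X in _ * X]mxE mulr0.
  rewrite u0 (indep w) ?row_mx0 //; move: E1; by rewrite u0 mul0mx add0r.
exists (lsubmx (invmx K)), (rsubmx (invmx K)) => a r r0 /=.
by apply: (split_ a r) => //; rewrite -mul_mx_row hsubmxK mulmxKV.
Qed.

End LinAlg.

Section GradBar.
Variables (R : realType) (dx dy dh : nat) (h : 'I_dh -> 'rV[R]_dx -> 'rV[R]_dy -> R).

(** Decides which of the two Gram matrices defines the singular values. *)
Lemma LICQ_card x y : LICQ h x y -> (#|active h x y| <= dy)%N.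
Proof.
rewrite /LICQ /free size_map -cardE => /eqP <-.
rewrite (leq_trans (dimvS (subvf _))) // dimvf dim_matrix.
change (1 * dy <= dy)%N; by rewrite mul1n.
Qed.

Lemma grad_bar_lower x y (s0 : R) : LICQ h x y -> 0 < s0 ->
  (forall s, singular_value (grad_bar h (active h x y) x y) s -> s0 <= s) ->
  forall w : 'rV[R]_dh, (forall i, i \notin active h x y -> w ord0 i = 0) ->
    s0 * enorm w <= enorm (\sum_i w ord0 i *: grad_y (h i) x y).
Proof.
move=> /LICQ_card cI s00 H w w0; set I := active h x y in cI H w0.
pose w' : 'rV[R]_#|I| := \row_k w ord0 (enum_val k).
have sumI (V : nmodType) (F : 'I_dh -> V) : (forall i, i \notin I -> F i = 0) ->
    \sum_i F i = \sum_(k < #|I|) F (enum_val k).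
  move=> F0; rewrite (bigID (mem I)) /= [X in _ + X]big1 ?addr0 //.
  exact: big_enum_val.
have -> : enorm w = enorm w'.
  by rewrite /enorm sumI => [|i /w0 ->]; rewrite ?expr0n //; congr Num.sqrt; apply: eq_bigr => k _; rewrite mxE.
have -> : \sum_i w ord0 i *: grad_y (h i) x y = w' *m grad_bar h I x y.
  rewrite sumI => [|i /w0 ->]; rewrite ?scale0r // mulmx_sum_row; apply: eq_bigr => k _.
  by rewrite rowK mxE.
exact: singular_lower.
Qed.

End GradBar.

(** * Minimizers, multipliers and correction onto the active constraints *)

Section Argmin.
Variable R : realType.

(** The sublevel set of y0 is bounded because the quadratic term dominates the linear one. *)
Lemma quadratic_growth_min n (D : set 'rV[R]_n) (phi : 'rV[R]_n -> R) (m : R) y0 a :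
  0 < m -> closed D -> continuous phi -> D y0 ->
  (forall z, D z -> phi y0 + dot a (z - y0) + m / 2 * enorm (z - y0) ^+ 2 <= phi z) ->
  exists y, D y /\ forall z, D z -> phi y <= phi z.
Proof.
move=> m0 cD cphi Dy0 H.
pose A := D `&` [set z | phi z <= phi y0].
have A0 : A !=set0 by exists y0; split => //=.
have cA : compact A.
  apply: bounded_closed_compact; last first.
    apply: closedI => //; apply: (@closed_comp _ _ phi [set t | t <= phi y0]) => [w _|].
      exact: cphi.
    exact: closed_le.
  exists (enorm y0 + 2 * enorm a / m); split; first exact: num_real.
  move=> b bP z [Dz /= zle]; apply: le_trans (norm_le_enorm z) _; apply: le_trans (ltW bP).
  suff K : enorm (z - y0) <= 2 * enorm a / m.
    by rewrite -[z in enorm z](subrK y0) addrC (le_trans (enormD _ _)) // lerD.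
  rewrite ler_pdivlMr //.
  have := H z Dz; have := dot_norm_le a (z - y0); rewrite ler_norml => /andP[+ _].
  have [->|zN] := eqVneq (enorm (z - y0)) 0; first by rewrite mul0r mulr_ge0 ?enorm_ge0.
  have zp : 0 < enorm (z - y0) by rewrite lt_def zN enorm_ge0.
  move=> B C; rewrite -(ler_pM2l zp); nra.
have [c Ac cmin] := EVT_min_rV A0 cA (continuous_subspaceT cphi).
rewrite inE in Ac; exists c; split; first by case: Ac.
move=> z Dz; have [zle|/ltW zgt] := leP (phi z) (phi y0).
  by apply: cmin; rewrite inE.
by apply: le_trans zgt; case: Ac.
Qed.

Lemma argmin_min (T : pointedType) (D : set T) (F : T -> R) :
  (exists y, D y /\ forall z, D z -> F y <= F z) ->
  D (argmin D F) /\ forall z, D z -> F (argmin D F) <= F z.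
Proof. by move=> H; have := getPex H. Qed.
End Argmin.

Section KKT.
Variables (R : realType) (dx dy dh : nat) (h : 'I_dh -> 'rV[R]_dx -> 'rV[R]_dy -> R).

Definition active_independent x y := forall w : 'rV[R]_dh,
  (forall i, i \notin active h x y -> w ord0 i = 0) ->
  \sum_i w ord0 i *: grad_y (h i) x y = 0 -> w = 0.

(** Solvability of the saddle-point system with identity block. *)
Lemma active_right_inverse x y : active_independent x y ->
  exists S : 'M[R]_(dh, dy), forall w i, i \in active h x y ->
    dot (grad_y (h i) x y) (w *m S) = w ord0 i.
Proof.
move=> ind; have co u : 1 * enorm u ^+ 2 <= dot (u *m (1%:M : 'M[R]_dy)) u.
  by rewrite mulmx1 dotvv mul1r.
have [M [N MN]] := saddle_solve (@ltr01 R) co ind.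
pose P : 'M[R]_dh := diag_mx (\row_i (i \in active h x y)%:R).
exists (row_mx 0 P *m M) => w i iI.
have PE j : (w *m P) ord0 j = w ord0 j * (j \in active h x y)%:R by rewrite mul_mx_diag !mxE.
have -> : w *m (row_mx 0 P *m M) = row_mx 0 (w *m P) *m M.
  by rewrite mulmxA mul_mx_row mulmx0.
have [|_ -> // _] := MN 0 (w *m P); first by move=> j jI; rewrite PE (negbTE jI) mulr0.
by rewrite PE iI mulr1.
Qed.

(** The point is approached along a direction in which all active constraints decrease at unit
    rate. *)
Lemma active_interior x y : feasible h x y ->
  (forall i, twice_differentiable_at (joint (h i)) (row_mx x y)) ->
  active_independent x y -> interior_limit h (row_mx x y).
Proof.
move=> fy dh2 /active_right_inverse[S SP].
apply: (@interior_limitP _ _ _ _ _ _ _ (- (const_mx 1) *m S)) => // i iI.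
by rewrite SP // !mxE oppr_lt0.
Qed.

Lemma feasible_first_order (G : 'rV[R]_dx -> 'rV[R]_dy -> R) x y v : feasible h x y ->
  (forall z, feasible h x z -> G x y <= G x z) ->
  differentiable (joint G) (row_mx x y) ->
  (forall i, differentiable (joint (h i)) (row_mx x y)) ->
  (forall i, i \in active h x y -> dot (grad_y (h i) x y) v < 0) ->
  0 <= dot (grad_y G x y) v.
Proof.
move=> fy ymin dG dfh hv; apply/ler_addgt0Pr => e e0.
have [r r0 rP] := feasible_direction fy dfh hv.
have [q q0 qP] := along_line (row_mx 0 v) (diff_expand dG) e0.
pose s := Num.min r q / 2.
have : 0 < s < Num.min r q.
  have m0 : 0 < Num.min r q by rewrite lt_min r0.
  by rewrite /s divr_gt0 //= ltr_pdivrMr // ltr_pMr // ltr1n.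
move=> /andP[s0]; rewrite lt_min => /andP[sr sq].
have fs : feasible h x (y + s *: v).
  move=> i; have := rP s; rewrite s0 => /(_ sr) /(_ i).
  by rewrite -row_mx_line joint_row => /ltW.
have := qP s; rewrite (gtr0_norm s0) => /(_ sq).
rewrite -row_mx_line !joint_row dotZr -dot_grad_y ler_norml => /andP[_].
move=> B; have := ymin _ fs => C; rewrite -(ler_pM2l s0); lra.
Qed.

(** Solve u + sum_i w_i grad_y h_i = - grad_y G with u tangent to the active constraints.  The slope
    of G along u is - |u|^2, so u = 0 by minimality and w is the multiplier.  Its signs come from
    directions that decrease one active constraint and keep the others to first order. *)
Lemma kkt_exists (G : 'rV[R]_dx -> 'rV[R]_dy -> R) x y : feasible h x y ->
  (forall z, feasible h x z -> G x y <= G x z) ->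
  differentiable (joint G) (row_mx x y) ->
  (forall i, differentiable (joint (h i)) (row_mx x y)) ->
  active_independent x y ->
  exists lam : 'rV[R]_dh, [/\ forall i, 0 <= lam ord0 i,
    grad_y G x y + \sum_i lam ord0 i *: grad_y (h i) x y = 0 &
    forall i, lam ord0 i * h i x y = 0].
Proof.
move=> fy ymin dG dfh ind.
have [S SP] := active_right_inverse ind.
have fo v : (forall i, i \in active h x y -> dot (grad_y (h i) x y) v <= 0) ->
    0 <= dot (grad_y G x y) v.
  move=> hv; apply/ler_addgt0Pr => e e0.
  set v0 := (- (const_mx 1) : 'rV[R]_dh) *m S.
  have k0 : 0 < `|dot (grad_y G x y) v0| + 1 by rewrite ltr_wpDl.
  pose s := e / (`|dot (grad_y G x y) v0| + 1).
  have s0 : 0 < s by rewrite divr_gt0.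
  have := @feasible_first_order G x y (v + s *: v0) fy ymin dG dfh.
  rewrite dotDr dotZr => H; apply: (le_trans (H _)) => [i iI|].
    by rewrite dotDr dotZr SP // !mxE mulrN1 subr_lt0 (le_lt_trans (hv i iI)).
  rewrite lerD2l /s mulrAC -mulrA ler_piMr ?(ltW e0) // ler_pdivrMr // mul1r.
  by rewrite (le_trans (ler_norm _)) // lerDl.
have co u : 1 * enorm u ^+ 2 <= dot (u *m (1%:M : 'M[R]_dy)) u.
  by rewrite mulmx1 dotvv mul1r.
have [M [N MN]] := saddle_solve (@ltr01 R) co ind.
have [|] := MN (- grad_y G x y) 0; first by move=> i _; rewrite mxE.
set u := _ *m M; set w := _ *m N; rewrite mulmx1 => E1 E2 E3.
have sum0 v : (forall i, i \in active h x y -> dot (grad_y (h i) x y) v = 0) ->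
    dot (\sum_i w ord0 i *: grad_y (h i) x y) v = 0.
  move=> v0; rewrite dot_suml big1 // => i _; rewrite dotZl.
  by have [/v0 ->|/E3 ->] := boolP (i \in active h x y); rewrite ?mulr0 ?mul0r.
have tu i : i \in active h x y -> dot (grad_y (h i) x y) u = 0.
  by move=> iI; rewrite E2 // mxE.
have u0 : u = 0.
  apply: enorm_eq0; apply/eqP; rewrite -sqrf_eq0 -dotvv; apply/eqP/le_anti.
  rewrite {2}dotvv sqr_ge0 andbT.
  have -> : dot u u = - dot (grad_y G x y) u.
    by rewrite -dotNl -E1 dotDl (sum0 u tu) addr0.
  by rewrite oppr_le0; apply: fo => i iI; rewrite tu.
have stat : grad_y G x y + \sum_i w ord0 i *: grad_y (h i) x y = 0.
  by apply/eqP; rewrite addrC addr_eq0 -E1 u0 add0r.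
exists w; split=> // i; last first.
  have [|/E3 ->] := boolP (i \in active h x y); last by rewrite mul0r.
  by rewrite inE => /eqP ->; rewrite mulr0.
have [iI|/E3 -> //] := boolP (i \in active h x y).
set v := (- delta_mx ord0 i : 'rV[R]_dh) *m S.
have hv j : j \in active h x y -> dot (grad_y (h j) x y) v = - (j == i)%:R.
  by move=> jI; rewrite SP // !mxE eqxx.
have : 0 <= dot (grad_y G x y) v by apply: fo => j jI; rewrite hv // oppr_le0 ler0n.
have -> : grad_y G x y = - \sum_i w ord0 i *: grad_y (h i) x y.
  by apply/eqP; rewrite -addr_eq0 stat.
rewrite dotNl dot_suml (bigD1 i) //= dotZl hv // eqxx big1 ?addr0.
  by rewrite mulrN1 opprK.
move=> j ji; rewrite dotZl.
have [jI|/E3 ->] := boolP (j \in active h x y); last by rewrite mul0r.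
by rewrite hv // (negbTE ji) oppr0 mulr0.
Qed.

(** Chord method: w |-> w - h(y + w S) is a contraction of the ball of radius 2 c because the
    constraints are strictly differentiable at (x, y) and S inverts their y-differential.  Its fixed
    point satisfies the constraints and has size O(c), where c bounds the initial violation. *)
Lemma constraint_correction (I : {set 'I_dh}) x y (S : 'M[R]_(dh, dy)) :
  (forall i, twice_differentiable_at (joint (h i)) (row_mx x y)) ->
  (forall w i, i \in I -> dot (grad_y (h i) x y) (w *m S) = w ord0 i) ->
  exists2 C : R, 0 <= C & exists2 r : R, 0 < r & forall (t : 'rV[R]_(dx + dy)) (c : R),
    enorm t < r -> 0 <= c < r -> (forall i, i \in I -> `|joint (h i) (row_mx x y + t)| <= c) ->
    exists2 v, enorm v <= C * c & forall i, i \in I -> joint (h i) (row_mx x y + t + row_mx 0 v) = 0.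
Proof.
move=> dh2 SP; set p := row_mx x y.
have [k0 k00 k0P] := mulmx_bounded S.
pose k := k0 * dh%:R.
have kge0 : 0 <= k by rewrite mulr_ge0.
have kP w : enorm (w *m S) <= k * `|w|.
  by rewrite (le_trans (k0P w)) // -mulrA ler_wpM2l // enorm_le_norm.
(* with this tolerance in the strict differentiability the map has ratio k / (2 k + 2) < 1 / 2 *)
have e0 : 0 < (2 * k + 2)^-1 by rewrite invr_gt0 ltr_wpDl ?mulr_ge0.
have [r0 r00 r0P] : exists2 r : R, 0 < r & forall uv : 'rV[R]_(dx + dy) * 'rV[R]_(dx + dy),
    Num.max (enorm uv.1) (enorm uv.2) < r -> forall i,
    `|joint (h i) (p + uv.2) - joint (h i) (p + uv.1) - dot (grad (joint (h i)) p) (uv.2 - uv.1)|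
       <= (2 * k + 2)^-1 * enorm (uv.2 - uv.1).
  apply: common_radius => i; have [r r0 rP] := strict_diff (dh2 i) e0; exists r => // uv.
  by rewrite gt_max => /andP[u1 u2]; exact: rP.
have K0 : 0 < 2 * k + 2 by rewrite ltr_wpDl ?mulr_ge0.
exists (2 * k); first by rewrite mulr_ge0.
exists (r0 / (2 * k + 2)); first by rewrite divr_gt0.
move=> t c; rewrite !ltr_pdivlMr // => tr /andP[c0 cr] hc.
pose U := [set w : 'rV[R]_dh | `|w| <= 2 * c].
pose T (w : 'rV[R]_dh) : 'rV[R]_dh :=
  \row_i (if i \in I then w ord0 i - joint (h i) (p + t + row_mx 0 (w *m S)) else 0).
have small w : U w -> enorm (t + row_mx 0 (w *m S)) < r0.
  move=> Uw; rewrite (le_lt_trans (enormD _ _)) // enorm_row_mx0l.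
  have A : enorm (w *m S) <= 2 * k * c.
    by rewrite (le_trans (kP w)) // -mulrA mulrCA ler_wpM2l.
  have := enorm_ge0 t; nra.
have contr w w' : U w -> U w' -> `|T w - T w'| <= 2^-1 * `|w - w'|.
  move=> /small Uw /small Uw'.
  rewrite [leLHS]/Num.norm /= mx_normrE; apply/bigmax_leP; split; first by rewrite mulr_ge0.
  move=> [j i] _; rewrite (ord1 j) !mxE; case: ifPn => iI /=; last by rewrite subr0 normr0 mulr_ge0.
  have := r0P (t + row_mx 0 (w *m S), t + row_mx 0 (w' *m S)) _ i.
  rewrite /= gt_max Uw Uw' => /(_ isT).
  have -> : t + row_mx 0 (w' *m S) - (t + row_mx 0 (w *m S)) = row_mx 0 ((w' - w) *m S).
    rewrite opprD addrACA subrr add0r -[- row_mx _ _]scaleN1r scale_row_mx add_row_mx.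
    by rewrite scaler0 addr0 scaleN1r mulmxBl.
  rewrite -dot_grad_y SP // enorm_row_mx0l !(addrA p) => B.
  rewrite distrC [X in `|X|](_ : _ = - (joint (h i) (p + t + row_mx 0 (w' *m S)) -
    joint (h i) (p + t + row_mx 0 (w *m S)) - (w' - w) ord0 i)); last by rewrite !mxE; ring.
  rewrite normrN (le_trans B) // [leLHS]mulrC ler_pdivrMr // (le_trans (kP _)) //.
  rewrite [X in _ * X]distrC; have := normr_ge0 (w - w'); nra.
have T0 : `|T 0| <= c.
  rewrite [leLHS]/Num.norm /= mx_normrE; apply/bigmax_leP; split => //.
  move=> [j i] _; rewrite (ord1 j) !mxE; case: ifPn => iI /=; last by rewrite normr0.
  by rewrite mul0mx row_mx0 addr0 sub0r normrN hc.
have U0 : U 0 by rewrite /U /= normr0 mulr_ge0.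
have TU : set_fun U U T.
  move=> w Uw; rewrite /U /=; have := contr w 0 Uw U0; rewrite subr0 => B.
  have := ler_normD (T w - T 0) (T 0); rewrite subrK.
  by rewrite /U /= in Uw; lra.
have cU : closed U.
  apply: (@closed_comp _ _ (fun w : 'rV[R]_dh => `|w|) [set s | s <= 2 * c]) => [w _|].
    exact: norm_continuous.
  exact: closed_le.
pose X := HB.pack_for (completeNormedModType R) 'rV[R]_dh.
have [|w Uw Tw] := @banach_fixed_point R X U (mkfun_fun TU) _ cU (ex_intro _ _ U0).
  exists (2^-1)%:nng; split => /=; first by rewrite invf_lt1 // ltr1n.
  by move=> [a b] /= [Ua Ub]; exact: contr.
exists (w *m S).
  by apply: le_trans (kP w) (le_trans (ler_wpM2l kge0 Uw) _); rewrite mulrCA mulrA.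
move=> i iI; have := congr1 (fun M : 'rV[R]_dh => M ord0 i) Tw.
rewrite /= /mkfun /T mxE iI => /eqP.
by rewrite -subr_eq0 opprB addrCA subrr addr0 => /eqP.
Qed.

End KKT.

(** * Sensitivity of the minimizer *)

Lemma near0W (R : realType) n (P : 'rV[R]_n -> Prop) :
  (forall u, P u) -> \forall u \near (0 : 'rV[R]_n), P u.
Proof. by move=> H; apply/near0_enorm; exists 1. Qed.

Section SmallO.
Variables (R : realType) (n : nat).
Implicit Types (f g : 'rV[R]_n -> R).

(** Only upper bounds are required: f stands for the norm of a remainder. *)
Definition smallo f := forall e : R, 0 < e ->
  \forall u \near (0 : 'rV[R]_n), f u <= e * enorm u.

Definition bigO f := exists2 c : R, 0 <= c &
  \forall u \near (0 : 'rV[R]_n), f u <= c * enorm u.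

Lemma smallo_le f g k : 0 <= k -> smallo g ->
  (\forall u \near (0 : 'rV[R]_n), f u <= k * g u) -> smallo f.
Proof.
move=> k0 Hg fg e e0; have k1 : 0 < k + 1 by rewrite ltr_wpDl.
have e1 : 0 < e / (k + 1) by rewrite divr_gt0.
apply: filterS2 fg (Hg _ e1) => u A B.
apply: le_trans A (le_trans (ler_wpM2l k0 B) _); rewrite mulrA ler_wpM2r ?enorm_ge0 //.
by rewrite mulrCA ler_piMr ?(ltW e0) // ler_pdivrMr // mul1r lerDl.
Qed.

Lemma smalloD f g : smallo f -> smallo g -> smallo (fun u => f u + g u).
Proof.
move=> Hf Hg e e0; have e2 : 0 < e / 2 by rewrite divr_gt0.
apply: filterS2 (Hf _ e2) (Hg _ e2) => u A B.
by rewrite (le_trans (lerD A B)) // -mulrDl -splitr.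
Qed.

Lemma smalloZ k f : 0 <= k -> smallo f -> smallo (fun u => k * f u).
Proof. by move=> k0 Hf; apply: (smallo_le k0 Hf); apply: near0W => u. Qed.

Lemma smallo_sum (J : finType) (P : pred J) (F : J -> 'rV[R]_n -> R) :
  (forall j, P j -> smallo (F j)) -> smallo (fun u => \sum_(j | P j) F j u).
Proof.
move=> H; elim: (index_enum J) => [|j s IHs].
  by move=> e e0; apply: near0W => u; rewrite big_nil mulr_ge0 ?enorm_ge0 // ltW.
have [Pj|Pj] := boolP (P j); move=> e e0.
  by apply: filterS (smalloD (H _ Pj) IHs e0) => u; rewrite big_cons Pj.
by apply: filterS (IHs _ e0) => u; rewrite big_cons (negbTE Pj).
Qed.

Lemma smallo_bigO f : smallo f -> bigO f.
Proof. by move=> H; exists 1; [|exact: H]. Qed.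

Lemma bigOD f g : bigO f -> bigO g -> bigO (fun u => f u + g u).
Proof.
move=> [c c0 Hc] [d d0 Hd]; exists (c + d); first by rewrite addr_ge0.
by apply: filterS2 Hc Hd => u A B; rewrite mulrDl lerD.
Qed.

Lemma smalloM f g : (forall u, 0 <= f u) -> (forall u, 0 <= g u) ->
  bigO f -> bigO g -> smallo (fun u => f u * g u).
Proof.
move=> f0 g0 [c c0 Hc] [d d0 Hd] e e0.
have k0 : 0 < c * d + 1 by rewrite ltr_wpDl ?mulr_ge0.
have small : \forall u \near (0 : 'rV[R]_n), enorm u < e / (c * d + 1).
  by apply/near0_enorm; exists (e / (c * d + 1)); rewrite ?divr_gt0.
apply: filterS3 Hc Hd small => u A B; rewrite ltr_pdivlMr // => /ltW D.
rewrite (le_trans (ler_pM _ _ A B)) // mulrACA mulrA ler_wpM2r ?enorm_ge0 //.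
by rewrite (le_trans _ D) // mulrC ler_wpM2l ?enorm_ge0 // lerDl.
Qed.

Lemma near_comp m (t : 'rV[R]_n -> 'rV[R]_m) (P : 'rV[R]_m -> Prop) :
  bigO (fun u => enorm (t u)) ->
  (\forall v \near (0 : 'rV[R]_m), P v) -> \forall u \near (0 : 'rV[R]_n), P (t u).
Proof.
move=> [c c0 Hc] /near0_enorm [r r0 rP].
have k0 : 0 < c + 1 by rewrite ltr_wpDl.
have small : \forall u \near (0 : 'rV[R]_n), enorm u < r / (c + 1).
  by apply/near0_enorm; exists (r / (c + 1)); rewrite ?divr_gt0.
apply: filterS2 Hc small => u A; rewrite ltr_pdivlMr // => D.
apply: rP; apply: le_lt_trans A (le_lt_trans _ D).
by rewrite mulrC ler_wpM2l ?enorm_ge0 // lerDl.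
Qed.

Lemma smallo_comp m (t : 'rV[R]_n -> 'rV[R]_m) (A : 'rV[R]_m -> R) :
  bigO (fun u => enorm (t u)) ->
  (forall e : R, 0 < e -> \forall v \near (0 : 'rV[R]_m), A v <= e * enorm v) ->
  smallo (fun u => A (t u)).
Proof.
move=> [c c0 Hc] HA e e0; have k0 : 0 < c + 1 by rewrite ltr_wpDl.
have := near_comp (ex_intro2 _ _ c c0 Hc) (HA _ (divr_gt0 e0 k0)).
apply: filterS2 Hc => u B D; apply: le_trans D _.
apply: le_trans (ler_wpM2l (ltW (divr_gt0 e0 k0)) B) _.
rewrite mulrA ler_wpM2r ?enorm_ge0 // mulrAC -mulrA ler_piMr ?(ltW e0) //.
by rewrite ler_pdivrMr // mul1r lerDl.
Qed.

Lemma bigO_small f r : bigO f -> 0 < r -> \forall u \near (0 : 'rV[R]_n), f u < r.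
Proof.
move=> [c c0 Hc] r0; have k0 : 0 < c + 1 by rewrite ltr_wpDl.
have small : \forall u \near (0 : 'rV[R]_n), enorm u < r / (c + 1).
  by apply/near0_enorm; exists (r / (c + 1)); rewrite ?divr_gt0.
apply: filterS2 Hc small => u A; rewrite ltr_pdivlMr // => D.
apply: le_lt_trans A (le_lt_trans _ D).
by rewrite mulrC ler_wpM2l ?enorm_ge0 // lerDl.
Qed.

Lemma bigO_enorm_mulmx m (M : 'M[R]_(n, m)) : bigO (fun u => enorm (u *m M)).
Proof. by have [c c0 cP] := mulmx_bounded M; exists c => //; apply: near0W. Qed.

Lemma bigO_le f g k : 0 <= k -> bigO g ->
  (\forall u \near (0 : 'rV[R]_n), f u <= k * g u) -> bigO f.
Proof.
move=> k0 [c c0 Hc] fg; exists (k * c); first by rewrite mulr_ge0.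
by apply: filterS2 fg Hc => u A B; rewrite (le_trans A) // -mulrA ler_wpM2l.
Qed.
End SmallO.

Lemma near0_forall (R : realType) n (J : finType) (P : J -> 'rV[R]_n -> Prop) :
  (forall j, \forall u \near (0 : 'rV[R]_n), P j u) ->
  \forall u \near (0 : 'rV[R]_n), forall j, P j u.
Proof.
move=> H; apply/near0_enorm; apply: common_radius => j.
exact/near0_enorm/H.
Qed.

Section Sensitivity.
Variables (R : realType) (dx dy dh : nat) (h : 'I_dh -> 'rV[R]_dx -> 'rV[R]_dy -> R).
Variables (G : 'rV[R]_dx -> 'rV[R]_dy -> R) (x : 'rV[R]_dx) (y : 'rV[R]_dy).
Variables (lam : 'rV[R]_dh) (m c : R).
Let p := row_mx x y.
Let I := active h x y.

Definition lagrangian_hess := hess (joint G) p + \sum_i lam ord0 i *: hess (joint (h i)) p.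

Hypothesis fy : feasible h x y.
Hypothesis G2 : twice_differentiable_at (joint G) p.
Hypothesis h2 : forall i, twice_differentiable_at (joint (h i)) p.
Hypothesis ind : active_independent h x y.
Hypothesis c0 : 0 < c.
Hypothesis coer : forall v,
  c * enorm v ^+ 2 <= dot (row_mx 0 v *m lagrangian_hess) (row_mx 0 v).

(** The equations satisfied by the derivatives M of the minimizer and N of the multiplier: the
    differential of the stationarity condition and of the active constraints. *)
Definition linearized (M : 'M[R]_(dx, dy)) (N : 'M[R]_(dx, dh)) :=
  forall xi, let t := row_mx xi (xi *m M) in
  [/\ rsubmx (t *m lagrangian_hess) + \sum_i (xi *m N) ord0 i *: grad_y (h i) x y = 0,
      forall i, i \in I -> dot (grad (joint (h i)) p) t = 0 &
      forall i, i \notin I -> (xi *m N) ord0 i = 0].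

(** The system is a saddle-point system for the y-block of the Hessian; its right-hand side is
    linear in xi, hence so is the solution. *)
Lemma linearized_exists : exists M N, linearized M N.
Proof.
have rE (a : 'rV[R]_dx) (u : 'rV[R]_dy) : rsubmx (row_mx a u *m lagrangian_hess) =
    a *m ursubmx lagrangian_hess + u *m drsubmx lagrangian_hess.
  by rewrite -{1}[lagrangian_hess]submxK mul_row_block row_mxKr.
have co u : c * enorm u ^+ 2 <= dot (u *m drsubmx lagrangian_hess) u.
  apply: le_trans (coer u) _.
  by rewrite dot_sub row_mxKl row_mxKr dot0r add0r rE mul0mx add0r.
have [M [N MN]] := saddle_solve c0 co ind.
pose C : 'M[R]_(dx, dh) := \matrix_(j, i) (if i \in I then - grad (joint (h i)) p ord0 (lshift dy j) else 0).
have CE xi i : (xi *m C) ord0 i = if i \in I then - dot (lsubmx (grad (joint (h i)) p)) xi else 0.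
  rewrite mxE; case: ifPn => iI; last by rewrite big1 // => j _; rewrite !mxE (negbTE iI) mulr0.
  by rewrite -sumrN; apply: eq_bigr => j _; rewrite [C _ _]mxE iI [lsubmx _ _ _]mxE mulrN mulrC.
pose Q := row_mx (- ursubmx lagrangian_hess) C.
exists (Q *m M), (Q *m N) => xi t.
have QE : xi *m Q = row_mx (- (xi *m ursubmx lagrangian_hess)) (xi *m C).
  by rewrite mul_mx_row mulmxN.
have [|E1 E2 E3] := MN (- (xi *m ursubmx lagrangian_hess)) (xi *m C).
  by move=> i iI; rewrite CE (negbTE iI).
rewrite /t mulmxA mulmxA QE; split=> //.
  by rewrite rE -addrA E1 subrr.
move=> i iI; rewrite dot_sub row_mxKl row_mxKr -grad_yE E2 // CE iI subrr //.
Qed.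

Hypothesis m0 : 0 < m.
Hypothesis Gfoc : first_order_convex h m G.
Hypothesis hfoc : forall i, first_order_convex h 0 (h i).
Hypothesis stat : grad_y G x y + \sum_i lam ord0 i *: grad_y (h i) x y = 0.
Hypothesis lam_pos : forall i, i \in I -> 0 < lam ord0 i.
Hypothesis lam_zero : forall i, i \notin I -> lam ord0 i = 0.
Variable ysel : 'rV[R]_dx -> 'rV[R]_dy.
Hypothesis ysel_feasible : forall x', feasible h x' (ysel x').
Hypothesis ysel_min : forall x' z, feasible h x' z -> G x' (ysel x') <= G x' z.

(** Along d = ysel x' - z the constraints with positive weight do not increase, by convexity, so the
    slope of G along d is at least <rho, d> where rho is the residual; strong convexity and
    minimality of ysel x' then give m / 2 |d|^2 <= |rho| |d|. *)
Lemma near_stationary x' z (mu : 'rV[R]_dh) : feasible h x' z ->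
  (forall i, 0 <= mu ord0 i) -> (forall i, mu ord0 i * h i x' z = 0) ->
  enorm (ysel x' - z) <=
    2 / m * enorm (grad_y G x' z + \sum_i mu ord0 i *: grad_y (h i) x' z).
Proof.
move=> fz mu0 comp; set rho := grad_y G x' z + _; set d := ysel x' - z.
have A := Gfoc fz (ysel_feasible x'); rewrite -/d in A.
have B := ysel_min fz.
have C : dot (\sum_i mu ord0 i *: grad_y (h i) x' z) d <= 0.
  rewrite dot_suml sumr_le0 // => i _; rewrite dotZl.
  have := hfoc i fz (ysel_feasible x'); rewrite -/d mul0r mul0r addr0 => D.
  apply: (@le_trans _ _ (mu ord0 i * (h i x' (ysel x') - h i x' z))).
    by rewrite ler_wpM2l ?mu0 // lerBrDl.
  by rewrite mulrBr comp subr0 mulr_ge0_le0 ?mu0 // ysel_feasible.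
have D := dot_norm_le rho d; rewrite ler_norml in D; case/andP: D => D _.
have E : dot rho d = dot (grad_y G x' z) d + dot (\sum_i mu ord0 i *: grad_y (h i) x' z) d.
  by rewrite -dotDl.
have [->|dN] := eqVneq (enorm d) 0; first by rewrite mulr_ge0 ?enorm_ge0 // divr_ge0 // ltW.
have dp : 0 < enorm d by rewrite lt_def dN enorm_ge0.
rewrite mulrAC ler_pdivlMr // -(ler_pM2l dp); nra.
Qed.

(** The corrected prediction z xi = y + xi M + v xi is feasible, and by the linearized system the
    residual of its optimality conditions with multiplier lam + xi N consists of Taylor remainders
    of gradients at p and of products of two first-order terms.  It is therefore o(|xi|), and
    near_stationary applies.  Strict complementarity keeps lam + xi N nonnegative. *)
Lemma argmin_expand M N : linearized M N ->
  smallo (fun xi => enorm (ysel (x + xi) - y - xi *m M)).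
Proof.
move=> lin.
have [S SP] := active_right_inverse ind.
have [C C0 [r r0 rP]] := constraint_correction h2 SP.
pose t0 (xi : 'rV[R]_dx) : 'rV[R]_(dx + dy) := row_mx xi (xi *m M).
have t0O : bigO (fun xi => enorm (t0 xi)).
  have H : bigO (fun xi : 'rV[R]_dx => enorm xi + enorm (xi *m M)).
    by apply: bigOD; [exists 1 => //; apply: near0W => u; rewrite mul1r | exact: bigO_enorm_mulmx].
  by apply: (bigO_le ler01 H); apply: near0W => u; rewrite mul1r enorm_row_mx.
pose res xi := \sum_(i in I) `|joint (h i) (p + t0 xi)|.
have res0 xi : 0 <= res xi by apply: sumr_ge0.
have reso : smallo res.
  apply: smallo_sum => i iI.
  have H := smallo_comp t0O (diff_expand (nbhs_singleton (h2 i).1)).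
  apply: (smallo_le ler01 H); apply: near0W => xi.
  have [_ /(_ i iI) -> _] := lin xi; rewrite mul1r joint_row.
  by move: (iI); rewrite inE => /eqP ->; rewrite !subr0.
have : forall xi, exists v : 'rV[R]_dy, enorm (t0 xi) < r -> res xi < r ->
    enorm v <= C * res xi /\ forall i, i \in I -> joint (h i) (p + t0 xi + row_mx 0 v) = 0.
  move=> xi; have [t0r|t0r] := ltP (enorm (t0 xi)) r; last by exists 0.
  have [rr|rr] := ltP (res xi) r; last by exists 0.
  have [||v v1 v2] := rP _ (res xi) t0r; first by rewrite res0.
    move=> i iI; rewrite /res (bigD1 i) //= lerDl.
    by apply: sumr_ge0.
  by exists v.
move=> /choice [v vP].
have cond : \forall xi \near (0 : 'rV[R]_dx), enorm (t0 xi) < r /\ res xi < r.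
  by apply: filterS2 (bigO_small t0O r0) (bigO_small (smallo_bigO reso) r0).
have vo : smallo (fun xi => enorm (v xi)).
  by apply: (smallo_le C0 reso); apply: filterS cond => xi [A B]; case: (vP xi A B).
pose t xi := t0 xi + row_mx 0 (v xi).
have tO : bigO (fun xi => enorm (t xi)).
  apply: (bigO_le ler01 (bigOD t0O (smallo_bigO vo))); apply: near0W => xi.
  by rewrite mul1r (le_trans (enormD _ _)) // enorm_row_mx0l.
pose z xi := y + xi *m M + v xi.
have zE xi : row_mx (x + xi) (z xi) = p + t xi.
  by rewrite /p /t /t0 /z !add_row_mx addr0 addrA.
pose mu xi := lam + xi *m N.
have muI xi i : i \notin I -> mu xi ord0 i = 0.
  by move=> iI; have [_ _ /(_ i iI) E] := lin xi; rewrite mxE lam_zero // E add0r.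
have mu0 : \forall xi \near (0 : 'rV[R]_dx), forall i, 0 <= mu xi ord0 i.
  apply: near0_forall => i; have [iI|iI] := boolP (i \in I); last first.
    by apply: near0W => xi; rewrite muI.
  apply: filterS (bigO_small (bigO_enorm_mulmx N) (lam_pos iI)) => xi A.
  have := coord_le_enorm (xi *m N) i; rewrite ler_norml => /andP[B _].
  rewrite mxE; lra.
have feas : \forall xi \near (0 : 'rV[R]_dx), forall i,
    joint (h i) (p + t xi) <= 0 /\ (i \in I -> joint (h i) (p + t xi) = 0).
  apply: near0_forall => i; have [iI|iI] := boolP (i \in I).
    apply: filterS cond => xi [A B]; have [_ /(_ i iI)] := vP xi A B.
    by rewrite /t addrA => ->.
  have hi : h i x y < 0 by rewrite lt_neqAle fy andbT; move: iI; rewrite inE.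
  have := near_comp tO (diff_expand (nbhs_singleton (h2 i).1) ltr01).
  set b := grad _ _.
  have k1 : 0 < 1 + enorm b by rewrite ltr_pwDl ?enorm_ge0.
  have k2 : 0 < - h i x y / (1 + enorm b) by rewrite divr_gt0 // oppr_gt0.
  apply: filterS2 (bigO_small tO k2) => xi; rewrite ltr_pdivlMr // => A.
  rewrite mul1r ler_norml joint_row => /andP[_ B]; split=> //.
  have := dot_le b (t xi); lra.
pose Rm F xi := grad (joint F) (p + t xi) - grad (joint F) p - t xi *m hess (joint F) p.
have RmO F : twice_differentiable_at (joint F) p -> smallo (fun xi => enorm (Rm F xi)).
  by move=> F2; apply: (smallo_comp tO (diff_expand_rV F2.2)).
pose dg i xi := grad (joint (h i)) (p + t xi) - grad (joint (h i)) p.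
have dgO i : bigO (fun xi => enorm (dg i xi)).
  have [k k0 kP] := mulmx_bounded (hess (joint (h i)) p).
  have H : bigO (fun xi => enorm (t xi *m hess (joint (h i)) p)).
    by apply: (bigO_le k0 tO); apply: near0W => xi.
  apply: (bigO_le ler01 (bigOD (smallo_bigO (RmO _ (h2 i))) H)); apply: near0W => xi.
  by rewrite mul1r (le_trans _ (enormD _ _)) // /Rm subrK.
have [kH kH0 kHP] := mulmx_bounded lagrangian_hess.
pose err xi := enorm (Rm G xi) + \sum_i lam ord0 i * enorm (Rm (h i) xi) +
  (kH * enorm (v xi) + \sum_i enorm (xi *m N) * enorm (dg i xi)).
have lam0 i : 0 <= lam ord0 i.
  by have [/lam_pos/ltW|/lam_zero ->] := boolP (i \in I).
have erro : smallo err.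
  apply: smalloD; apply: smalloD.
  - exact: RmO.
  - by apply: smallo_sum => i _; apply: smalloZ => //; exact: RmO.
  - exact: smalloZ.
  - apply: smallo_sum => i _; apply: smalloM => //; try by move=> u; exact: enorm_ge0.
    exact: bigO_enorm_mulmx.
have rho_le xi : enorm (grad_y G (x + xi) (z xi) +
    \sum_i mu xi ord0 i *: grad_y (h i) (x + xi) (z xi)) <= err xi.
  have -> : grad_y G (x + xi) (z xi) + \sum_i mu xi ord0 i *: grad_y (h i) (x + xi) (z xi) =
     rsubmx (Rm G xi + \sum_i lam ord0 i *: Rm (h i) xi + (row_mx 0 (v xi) *m lagrangian_hess +
       \sum_i (xi *m N) ord0 i *: dg i xi)).
    have sumE (w : 'rV[R]_dh) q : \sum_i w ord0 i *: grad_y (h i) (lsubmx q) (rsubmx q) =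
        rsubmx (\sum_i w ord0 i *: grad (joint (h i)) q).
      by rewrite linear_sum; apply: eq_bigr => i _; rewrite grad_yE hsubmxK linearZ.
    have := sumE (mu xi) (p + t xi); rewrite -zE row_mxKl row_mxKr => ->; rewrite zE.
    rewrite grad_yE zE -linearD /=.
    have [+ _ _] := lin xi; rewrite -/(t0 xi).
    have := sumE (xi *m N) p; rewrite /p row_mxKl row_mxKr -/p => -> L1.
    have := stat; have := sumE lam p; rewrite /p row_mxKl row_mxKr -/p => -> L2.
    rewrite grad_yE -/p in L2.
    set X := (X in rsubmx X); set Y := (X in _ = rsubmx X).
    have -> : X = Y + (grad (joint G) p + \sum_i lam ord0 i *: grad (joint (h i)) p) +
        (t0 xi *m lagrangian_hess + \sum_i (xi *m N) ord0 i *: grad (joint (h i)) p).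
      rewrite /X /Y.
      have -> : \sum_i mu xi ord0 i *: grad (joint (h i)) (p + t xi) =
        \sum_i lam ord0 i *: grad (joint (h i)) (p + t xi) +
        \sum_i (xi *m N) ord0 i *: grad (joint (h i)) (p + t xi).
        by rewrite -big_split; apply: eq_bigr => i _; rewrite mxE scalerDl.
      have -> : \sum_i (xi *m N) ord0 i *: dg i xi =
        \sum_i (xi *m N) ord0 i *: grad (joint (h i)) (p + t xi) -
        \sum_i (xi *m N) ord0 i *: grad (joint (h i)) p.
        by rewrite -sumrB; apply: eq_bigr => i _; rewrite scalerBr.
      have -> : \sum_i lam ord0 i *: Rm (h i) xi =
        \sum_i lam ord0 i *: grad (joint (h i)) (p + t xi) -
        \sum_i lam ord0 i *: grad (joint (h i)) p -
        t xi *m \sum_i lam ord0 i *: hess (joint (h i)) p.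
        rewrite mulmx_sumr -!sumrB; apply: eq_bigr => i _.
        by rewrite -scalemxAr -!scalerBr.
      have -> : t0 xi *m lagrangian_hess = t xi *m hess (joint G) p +
          t xi *m (\sum_i lam ord0 i *: hess (joint (h i)) p) - row_mx 0 (v xi) *m lagrangian_hess.
        by rewrite -mulmxDr -/lagrangian_hess -mulmxBl addrK.
      rewrite /Rm.
      move: (grad (joint G) (p + t xi)) (grad (joint G) p) (t xi *m hess _ _) (t xi *m \sum_i _).
      move: (\sum_i _) (\sum_i _) (\sum_i _) (\sum_i _) (_ *m lagrangian_hess) => *.
      by apply/rowP => ?; rewrite !mxE; ring.
    have rD (a b : 'rV[R]_(dx + dy)) : rsubmx (a + b) = rsubmx a + rsubmx b by rewrite linearD.
    by rewrite (rD (Y + _)) (rD Y) (rD (grad _ p)) L2 (rD (t0 xi *m _)) L1 !addr0.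
  rewrite (le_trans (enorm_rsubmx _)) // (le_trans (enormD _ _)) //; apply: lerD.
    rewrite (le_trans (enormD _ _)) //; apply: lerD => //.
    rewrite (le_trans (enorm_sum _ _)) //; apply: ler_sum => i _.
    by rewrite enormZ ger0_norm.
  rewrite (le_trans (enormD _ _)) //; apply: lerD.
    by rewrite (le_trans (kHP _)) // enorm_row_mx0l.
  rewrite (le_trans (enorm_sum _ _)) //; apply: ler_sum => i _.
  by rewrite enormZ ler_wpM2r ?enorm_ge0 // coord_le_enorm.
have k0 : 0 <= 2 / m by rewrite divr_ge0 // ltW.
apply: (smallo_le ler01 (smalloD (smalloZ k0 erro) vo)).
apply: filterS2 mu0 feas => xi A B.
have fz : feasible h (x + xi) (z xi).
  by move=> i; have [+ _] := B i; rewrite -zE joint_row.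
have := near_stationary fz A; rewrite mul1r => H.
have -> : ysel (x + xi) - y - xi *m M = (ysel (x + xi) - z xi) + v xi.
  by rewrite /z !opprD !addrA subrK.
rewrite (le_trans (enormD _ _)) // lerD // (le_trans (H _)) ?ler_wpM2l //.
move=> i; have [iI|/muI ->] := boolP (i \in I); last by rewrite mul0r.
by have [_ /(_ iI)] := B i; rewrite -zE joint_row => ->; rewrite mulr0.
Qed.
End Sensitivity.

(** * The penalized problem and its value function *)

Section Combination.
Variables (R : realType) (n : nat).

Lemma grad_comb (F H : 'rV[R]_n -> R) (t : R) p : differentiable F p -> differentiable H p ->
  differentiable (fun q => t * F q + H q) p /\
  grad (fun q => t * F q + H q) p = t *: grad F p + grad H p.
Proof.
move=> dF dH; apply: expand_diff => e e0.
have k0 : 0 < `|t| + 1 by rewrite ltr_wpDl.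
have e1 : 0 < e / (`|t| + 1) by rewrite divr_gt0.
apply: filterS2 (diff_expand dF e1) (diff_expand dH e1) => v A B.
rewrite dotDl dotZl [X in `|X|](_ : _ = t * (F (p + v) - F p - dot (grad F p) v) +
  (H (p + v) - H p - dot (grad H p) v)); last by ring.
rewrite (le_trans (ler_normD _ _)) // normrM (le_trans (lerD (ler_wpM2l _ A) B)) //.
by rewrite -[X in _ + X]mul1r -mulrDl mulrA mulrCA divff ?gt_eqF // mulr1.
Qed.

Lemma grad_scaleB (F H : 'rV[R]_n -> R) (a : R) p : differentiable F p -> differentiable H p ->
  differentiable (fun q => a * (F q - H q)) p /\
  grad (fun q => a * (F q - H q)) p = a *: (grad F p - grad H p).
Proof.
move=> dF dH; apply: expand_diff => e e0.
have k0 : 0 < 2 * (`|a| + 1) by rewrite mulr_gt0 // ltr_wpDl.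
have e1 : 0 < e / (2 * (`|a| + 1)) by rewrite divr_gt0.
apply: filterS2 (diff_expand dF e1) (diff_expand dH e1) => v A B.
rewrite dotZl dotBl [X in `|X|](_ : _ = a * ((F (p + v) - F p - dot (grad F p) v) -
  (H (p + v) - H p - dot (grad H p) v))); last by ring.
rewrite normrM (le_trans (ler_wpM2l _ (le_trans (ler_normB _ _) (lerD A B)))) //.
rewrite -mulrDl mulrA ler_wpM2r ?enorm_ge0 //.
rewrite [leLHS](_ : _ = `|a| / (`|a| + 1) * e); last by field; rewrite gt_eqF // ltr_wpDl.
by rewrite ler_piMl ?(ltW e0) // ler_pdivrMr ?ltr_wpDl // mul1r lerDl.
Qed.

Lemma hess_comb (F H : 'rV[R]_n -> R) (t : R) p :
  (forall q, differentiable F q) -> (forall q, differentiable H q) ->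
  differentiable (grad F) p -> differentiable (grad H) p ->
  twice_differentiable_at (fun q => t * F q + H q) p /\
  hess (fun q => t * F q + H q) p = t *: hess F p + hess H p.
Proof.
move=> dF dH dF2 dH2.
have E : grad (fun q => t * F q + H q) = (t *: grad F) + grad H.
  by apply/funext => q; case: (grad_comb t (dF q) (dH q)).
have dZ : differentiable (t *: grad F) p by exact: differentiableZ.
split; first split.
- by apply/near_shift0/near0W => v; case: (grad_comb t (dF (p + v)) (dH (p + v))).
- by rewrite E; exact: differentiableD.
have key (v : 'rV[R]_n) : v *m jacobian ((t *: grad F) + grad H) p =
    t *: (v *m jacobian (grad F) p) + v *m jacobian (grad H) p.
  have dS : differentiable ((t *: grad F) + grad H) p by exact: differentiableD.
  transitivity ('D_v ((t *: grad F) + grad H) p); first exact: (esym (deriveEjacobian v dS)).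
  transitivity ('D_v (t *: grad F) p + 'D_v (grad H) p).
    by apply: deriveD; exact: diff_derivable.
  congr (_ + _); last exact: (deriveEjacobian v dH2).
  transitivity (t *: 'D_v (grad F) p); first by apply: deriveZ; exact: diff_derivable.
  by congr (_ *: _); exact: (deriveEjacobian v dF2).
rewrite /hess E; move: (jacobian (grad F) p) (jacobian (grad H) p) (jacobian _ p) key => A B C key.
by apply/row_matrixP => i; rewrite !rowE key mulmxDr scalemxAr.
Qed.

(** Chain rule along x' |-> (x', ysel x'), for an expansion of ysel at x in the Euclidean norm. *)
Lemma composite_diff dy (F : 'rV[R]_n -> 'rV[R]_dy -> R) x (ysel : 'rV[R]_n -> 'rV[R]_dy)
    (M : 'M[R]_(n, dy)) :
  differentiable (joint F) (row_mx x (ysel x)) ->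
  smallo (fun xi => enorm (ysel (x + xi) - ysel x - xi *m M)) ->
  differentiable (fun x' => F x' (ysel x')) x /\
  forall xi, dot (grad (fun x' => F x' (ysel x')) x) xi =
    dot (grad (joint F) (row_mx x (ysel x))) (row_mx xi (xi *m M)).
Proof.
move=> dF so; set p := row_mx x (ysel x); set gF := grad (joint F) p.
pose a := lsubmx gF + rsubmx gF *m M^T.
have aE xi : dot a xi = dot gF (row_mx xi (xi *m M)).
  by rewrite /a dotDl dot_mulmx trmxK (dot_sub gF) row_mxKl row_mxKr.
suff [d E] : differentiable (fun x' => F x' (ysel x')) x /\
    grad (fun x' => F x' (ysel x')) x = a by split=> // xi; rewrite E aE.
pose w xi := ysel (x + xi) - ysel x - xi *m M.
pose t xi : 'rV[R]_(n + dy) := row_mx xi (xi *m M) + row_mx 0 (w xi).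
have tE xi : p + t xi = row_mx (x + xi) (ysel (x + xi)).
  by rewrite /p /t !add_row_mx addr0 /w [xi *m M + _]addrC subrK [ysel x + _]addrC subrK.
have tO : bigO (fun xi => enorm (t xi)).
  have H : bigO (fun xi : 'rV[R]_n => enorm xi + enorm (xi *m M) + enorm (w xi)).
    apply: bigOD; last exact: smallo_bigO.
    by apply: bigOD; [exists 1 => //; apply: near0W => u; rewrite mul1r | exact: bigO_enorm_mulmx].
  apply: (bigO_le ler01 H); apply: near0W => u; rewrite mul1r (le_trans (enormD _ _)) //.
  by rewrite enorm_row_mx0l lerD // enorm_row_mx.
have E0 := smallo_comp tO (diff_expand dF).
have := smalloD E0 (smalloZ (enorm_ge0 gF) so); rewrite -/p -/gF => E1.
apply: expand_diff => e e0; apply: filterS (E1 e e0) => xi; apply: le_trans.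
rewrite aE tE joint_row /p joint_row -/(w xi).
have -> : dot gF (row_mx xi (xi *m M)) = dot gF (t xi) - dot gF (row_mx 0 (w xi)).
  by rewrite -dotBr /t addrK.
rewrite opprB addrA [_ + _ - _]addrAC (le_trans (ler_normD _ _)) // lerD2l.
by rewrite (le_trans (dot_norm_le _ _)) // enorm_row_mx0l.
Qed.
End Combination.

Lemma dot_mulmx_comb (R : realType) n m k (A : 'M[R]_(n, m)) (C : 'I_k -> 'M[R]_(n, m))
    (l : 'I_k -> R) u w :
  dot (u *m (A + \sum_i l i *: C i)) w = dot (u *m A) w + \sum_i l i * dot (u *m C i) w.
Proof.
rewrite mulmxDr dotDl mulmx_sumr dot_suml; congr (_ + _).
by apply: eq_bigr => i _; rewrite -scalemxAr dotZl.
Qed.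

Section Stage.
Variables (R : realType) (dx dy dh : nat) (f g : 'rV[R]_dx -> 'rV[R]_dy -> R)
  (h : 'I_dh -> 'rV[R]_dx -> 'rV[R]_dy -> R).
Variables (mu lf0 lf1 lf2 lg1 lg2 lh0 lh1 lh2 : R).
Hypothesis (mu_gt0 : 0 < mu) (lf2_ge0 : 0 <= lf2) (lg2_ge0 : 0 <= lg2) (lh2_ge0 : 0 <= lh2).
Hypothesis cf : cont_diff (joint f).
Hypothesis cg : cont_diff (joint g).
Hypothesis r1 : R1 f g h.
Hypothesis r2 : R2 f g h lf0 lf1 lg1.
Hypothesis r3 : R3 g h mu.
Hypothesis r4 : R4 f g h lf2 lg2 lh0 lh1 lh2.

Definition penalized (t : R) := fun x y => t * f x y + g x y.

Lemma f_twice p : feasible_joint h p -> twice_differentiable_at (joint f) p.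
Proof. by case: r4 => H _ _ _ /H []. Qed.

Lemma g_twice p : feasible_joint h p -> twice_differentiable_at (joint g) p.
Proof. by case: r4 => H _ _ _ /H []. Qed.

Lemma h_twice i p : feasible_joint h p -> twice_differentiable_at (joint (h i)) p.
Proof. by case: r4 => _ _ _ /(_ i) [H _ _ _ _] /H. Qed.

Lemma h_first_order i : first_order_convex h 0 (h i).
Proof.
apply: strong_first_order => [x|p /(h_twice i) [/nbhs_singleton]//].
by apply: convex_function_strong0; case: r4 => _ _ _ /(_ i) [].
Qed.

Lemma g_first_order : first_order_convex h mu g.
Proof. by apply: strong_first_order => // p _; case: cg. Qed.

Lemma f_first_order : first_order_convex h (- lf1) f.
Proof.
apply: lipschitz_first_order => [x|p _|]; [by case: r1 => /(_ x) [] | by case: cf |].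
by case: r2.
Qed.

Lemma penalized_diff t p : differentiable (joint (penalized t)) p /\
  grad (joint (penalized t)) p = t *: grad (joint f) p + grad (joint g) p.
Proof. by apply: grad_comb; [case: cf | case: cg]. Qed.

Lemma penalized_twice t p : feasible_joint h p ->
  twice_differentiable_at (joint (penalized t)) p /\
  hess (joint (penalized t)) p = t *: hess (joint f) p + hess (joint g) p.
Proof.
move=> Dp; apply: hess_comb; [by case: cf | by case: cg | by case: (f_twice Dp) |].
by case: (g_twice Dp).
Qed.

Lemma penalized_grad_y t x y :
  grad_y (penalized t) x y = t *: grad_y f x y + grad_y g x y.
Proof.
by rewrite !grad_yE (penalized_diff t _).2 linearD linearZ.
Qed.

Lemma penalized_first_order t : 0 <= t -> first_order_convex h (mu - t * lf1) (penalized t).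
Proof.
move=> t0 x y z fy fz.
have := ler_wpM2l t0 (f_first_order fy fz); have := g_first_order fy fz.
rewrite penalized_grad_y dotDl dotZl /penalized => A B.
have := lerD B A.
rewrite [X in X <= _ -> _](_ : _ = t * f x y + g x y +
  (t * dot (grad_y f x y) (z - y) + dot (grad_y g x y) (z - y)) +
  (mu - t * lf1) / 2 * enorm (z - y) ^+ 2) //; by field.
Qed.

(** In this range the weak convexity of t f costs at most half of the modulus mu of g. *)
Definition strong_range (t : R) := 0 <= t /\ 2 * (t * lf1) <= mu.

Lemma strong_modulus t : strong_range t -> 0 < mu - t * lf1.
Proof. move=> [_ H]; have := mu_gt0; move: (t * lf1) H => a H; lra. Qed.

Lemma ystar_t_min t x : strong_range t ->
  feasible h x (ystar_t f g h t x) /\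
  forall z, feasible h x z -> penalized t x (ystar_t f g h t x) <= penalized t x z.
Proof.
move=> st; apply: argmin_min.
have [[y0 fy0] cY _] := r1.1 x.
apply: (quadratic_growth_min (strong_modulus st) cY _ fy0) => [|z fz].
  have cj : continuous (joint (penalized t)).
    by move=> p; apply: differentiable_continuous; case: (penalized_diff t p).
  move=> y; have := cj (row_mx x y).
  move=> /(@cvgrPdist_le _ _ _ (nbhs (row_mx x y))) H.
  apply/(@cvgrPdist_le _ _ _ (nbhs y)) => e e0.
  have /near_shift0/near0_enorm[r r0 rP] := H e e0.
  apply/near_shift0/near0_enorm; exists r => // v vr.
  have := rP (row_mx 0 v); rewrite enorm_row_mx0l => /(_ vr).
  by rewrite add_row_mx addr0 !joint_row.
exact: penalized_first_order st.1 _ _ _ fy0 fz.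
Qed.

Lemma sup_max (A : set R) a : A a -> (forall b, A b -> b <= a) -> sup A = a.
Proof.
move=> Aa ub; apply/le_anti/andP; split; first by apply: ge_sup => //; exists a.
by apply: sup_upper_bound => //; split; exists a.
Qed.

Lemma inf_min (A : set R) a : A a -> (forall b, A b -> a <= b) -> inf A = a.
Proof.
move=> Aa lb; apply/le_anti/andP; split; last by apply: lb_le_inf => //; exists a.
by apply: ge_inf => //; exists a.
Qed.

Lemma strong_range0 : strong_range 0.
Proof. by split=> //; rewrite mul0r mulr0 ltW. Qed.

Lemma penalized0 : penalized 0 = g.
Proof. by apply/funext => x; apply/funext => y; rewrite /penalized mul0r add0r. Qed.

Lemma ystarE : ystar g h = ystar_t f g h 0.
Proof.
apply/funext => x; rewrite /ystar /ystar_t; congr argmin.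
by apply/funext => y; rewrite mul0r add0r.
Qed.

(** The inner maximum is attained at the minimizer of g, whatever y is, so the outer problem is the
    minimization of f + g / delta. *)
Lemma Phi_deltaE delta x : 0 < delta -> strong_range delta ->
  Phi_delta f g h delta x = delta^-1 *
    (penalized delta x (ystar_t f g h delta x) - penalized 0 x (ystar_t f g h 0 x)).
Proof.
move=> d0 sd.
have [fyd yd] := ystar_t_min x sd; have [fy0] := ystar_t_min x strong_range0.
rewrite penalized0 => y0; set v := ystar_t f g h delta x in fyd yd *.
set w := ystar_t f g h 0 x in fy0 y0 *.
have supE y : sup [set f x y + delta^-1 * (g x y - g x z) | z in feasible h x] =
    f x y + delta^-1 * (g x y - g x w).
  apply: sup_max => [|_ [z fz <-]]; first by exists w.
  by rewrite lerD2l ler_pM2l ?invr_gt0 // lerD2l lerN2 y0.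
have E y : f x y + delta^-1 * (g x y - g x w) = delta^-1 * (penalized delta x y - g x w).
  by rewrite /penalized; field; rewrite gt_eqF.
rewrite /Phi_delta; apply: inf_min => [|_ [z fz <-]]; rewrite -E.
  by exists v => //; rewrite supE.
by rewrite supE !E ler_pM2l ?invr_gt0 // lerD2r yd.
Qed.

Section AtParameter.
Variables (t : R) (x : 'rV[R]_dx) (s0 : R).
Let y := ystar_t f g h t x.
Let p := row_mx x y.
Let lam := lambda_t f g h t x.
Hypothesis st : strong_range t.
Hypothesis licq : LICQ h x y.
Hypothesis lam_pos : forall i, i \in active h x y -> 0 < lam ord0 i.
Hypothesis s0_gt0 : 0 < s0.
Hypothesis sing : forall s, singular_value (grad_bar h (active h x y) x y) s -> s0 <= s.

Lemma ystar_t_feasible : feasible h x y.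
Proof. by have [] := ystar_t_min x st. Qed.

Lemma ystar_t_joint : feasible_joint h p.
Proof. exact/feasible_row/ystar_t_feasible. Qed.

Lemma multiplier_lower (w : 'rV[R]_dh) : (forall i, i \notin active h x y -> w ord0 i = 0) ->
  s0 * enorm w <= enorm (\sum_i w ord0 i *: grad_y (h i) x y).
Proof. exact: grad_bar_lower. Qed.

Lemma ystar_t_independent : active_independent h x y.
Proof.
move=> w w0 E; have := multiplier_lower w0; rewrite E enorm0 pmulr_rle0 // => H.
by apply: enorm_eq0; apply/le_anti; rewrite H enorm_ge0.
Qed.

Lemma ystar_t_interior : interior_limit h p.
Proof.
apply: active_interior ystar_t_feasible _ ystar_t_independent => i.
exact: h_twice ystar_t_joint.
Qed.

Lemma lambda_t_KKT : [/\ forall i, 0 <= lam ord0 i,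
    grad_y (penalized t) x y + \sum_i lam ord0 i *: grad_y (h i) x y = 0 &
    forall i, i \notin active h x y -> lam ord0 i = 0].
Proof.
have [fy ymin] := ystar_t_min x st.
have [|l [l1 l2 l3]] := @kkt_exists _ _ _ _ h (penalized t) x y fy ymin (penalized_diff t p).1 _ ystar_t_independent.
  by move=> i; have [/nbhs_singleton] := h_twice i ystar_t_joint.
have : KKT f g h t x lam.
  by apply: (getPex (P := [set l | KKT f g h t x l])); exists l; split=> //; rewrite -penalized_grad_y.
move=> [k1 k2 k3]; split=> //; first by rewrite penalized_grad_y.
move=> i; rewrite inE => hi; have /eqP := k3 i; rewrite mulf_eq0 (negbTE hi) orbF.
by move=> /eqP.
Qed.

(** Sum of the coercivity bounds of f (with modulus - lf1), of g and of the convex constraints. *)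
Lemma lagrangian_coercive v : (mu - t * lf1) * enorm v ^+ 2 <=
  dot (row_mx 0 v *m lagrangian_hess h (penalized t) x y lam) (row_mx 0 v).
Proof.
have ip := ystar_t_interior; have Dp := ystar_t_joint.
have [lam0 _ _] := lambda_t_KKT.
have [_ lf lg lh] := r4.
have Hf := ler_wpM2l st.1 (hess_coercive lf2_ge0 f_twice lf Dp ip v f_first_order).
have Hg := hess_coercive lg2_ge0 g_twice lg Dp ip v g_first_order.
rewrite /lagrangian_hess (penalized_twice t Dp).2 dot_mulmx_comb mulmxDr dotDl -scalemxAr dotZl.
apply: (@le_trans _ _ (t * (- lf1 * enorm v ^+ 2) + mu * enorm v ^+ 2)).
  by rewrite le_eqVlt; apply/orP; left; apply/eqP; ring.
rewrite -[leLHS]addr0; apply: lerD; first exact: lerD Hf Hg.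
apply: sumr_ge0 => i _; apply: mulr_ge0; first exact: lam0.
have [_ _ _ _ lhi] := lh i.
have := hess_coercive lh2_ge0 (@h_twice i) lhi Dp ip v (h_first_order i).
by rewrite mul0r.
Qed.

Lemma ystar_t_sensitivity : exists M N,
  linearized h (penalized t) x y lam M N /\
  smallo (fun xi => enorm (ystar_t f g h t (x + xi) - y - xi *m M)).
Proof.
have m0 := strong_modulus st; have Dp := ystar_t_joint.
have [lam0 stat lamz] := lambda_t_KKT.
have P2 := (penalized_twice t Dp).1.
have h2 i : twice_differentiable_at (joint (h i)) p := h_twice i Dp.
have [M [N lin]] := linearized_exists ystar_t_independent m0 lagrangian_coercive.
exists M, N; split=> //.
exact: (argmin_expand ystar_t_feasible P2 h2 ystar_t_independent m0 (penalized_first_order st.1)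
  h_first_order stat lam_pos lamz (fun x' => (ystar_t_min x' st).1)
  (fun x' => (ystar_t_min x' st).2) lin).
Qed.

(** Envelope formula.  The gradient of the Lagrangian has no y-component, and the constraints with
    a nonzero multiplier are stationary along (xi, xi M), so the motion of the minimizer does not
    contribute. *)
Lemma value_diff (V := fun x' => penalized t x' (ystar_t f g h t x')) :
  differentiable V x /\
  grad V x = lsubmx (t *: grad (joint f) p + grad (joint g) p +
    \sum_i lam ord0 i *: grad (joint (h i)) p).
Proof.
have [M [N [lin so]]] := ystar_t_sensitivity.
have [lam0 stat lamz] := lambda_t_KKT.
have [dV E] := composite_diff (penalized_diff t p).1 so.
split=> //; apply/rowP => j; rewrite -(dot_delta j (grad V x)) -(dot_delta j (lsubmx _)).
rewrite ![dot (delta_mx _ _) _]dotC E; set xi := delta_mx ord0 j.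
have [_ L _] := lin xi; set tau := row_mx xi (xi *m M) in L *.
rewrite (penalized_diff t p).2; set gr := t *: _ + _.
set S := \sum_i _.
have S0 : dot S tau = 0.
  rewrite /S dot_suml big1 // => i _; rewrite dotZl.
  by have [/L ->|/lamz ->] := boolP (i \in active h x y); rewrite ?mulr0 ?mul0r.
have -> : dot gr tau = dot (gr + S) tau by rewrite [RHS]dotDl S0 addr0.
have sy : rsubmx (gr + S) = 0.
  rewrite -[RHS]stat linearD /= /gr /S -(penalized_diff t p).2 -grad_yE; congr (_ + _).
  by rewrite linear_sum; apply: eq_bigr => i _; rewrite linearZ /= grad_yE.
by rewrite dot_sub sy dot0l addr0 row_mxKl.
Qed.
End AtParameter.
End Stage.

(** * Comparison of the two gradients *)

Section Arith.
Variable R : realType.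

(** Either Y <= X, or one factor X of the last term may be replaced by Y. *)
Lemma quadratic_bound (a b mu X Y : R) : 0 <= a -> 0 <= b -> 0 <= X -> 0 <= Y -> 0 < mu ->
  mu * Y ^+ 2 <= a * X * Y + b * X ^+ 2 -> Y <= (1 + (a + b) / mu) * X.
Proof.
move=> a0 b0 X0 Y0 mu0 H.
have c0 : 0 <= (a + b) / mu by rewrite divr_ge0 ?addr_ge0 // ltW.
have [YX|XY] := leP Y X.
  by rewrite (le_trans YX) // ler_peMl // lerDl.
have Yp : 0 < Y by exact: le_lt_trans XY.
have K : mu * Y <= (a + b) * X.
  rewrite -(ler_pM2r Yp); have := ler_wpM2l (mulr_ge0 b0 X0) (ltW XY).
  rewrite !expr2 in H; nra.
rewrite mulrDl mul1r ler_wpDl // mulrAC ler_pdivlMr // mulrC //.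
Qed.

Lemma norm_sum_mul n (w : 'rV[R]_n) (a : 'I_n -> R) b : (forall i, `|a i| <= b) ->
  `|\sum_i w ord0 i * a i| <= n%:R * enorm w * b.
Proof.
move=> ab; rewrite (le_trans (ler_norm_sum _ _ _)) //.
rewrite (@le_trans _ _ (\sum_(i < n) enorm w * b)) //.
  by apply: ler_sum => i _; rewrite normrM ler_pM ?coord_le_enorm.
by rewrite sumr_const card_ord -[leLHS]mulr_natl mulrA.
Qed.

Lemma enorm_sum_mul n m (w : 'rV[R]_n) (a : 'I_n -> 'rV[R]_m) b : (forall i, enorm (a i) <= b) ->
  enorm (\sum_i w ord0 i *: a i) <= n%:R * enorm w * b.
Proof.
move=> ab; rewrite (le_trans (enorm_sum _ _)) //.
rewrite (@le_trans _ _ (\sum_(i < n) enorm w * b)) //.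
  by apply: ler_sum => i _; rewrite enormZ ler_pM ?enorm_ge0 ?coord_le_enorm.
by rewrite sumr_const card_ord -[leLHS]mulr_natl mulrA.
Qed.
End Arith.

Section Segment.
Variables (R : realType) (dx dy dh : nat) (h : 'I_dh -> 'rV[R]_dx -> 'rV[R]_dy -> R).
Variables (x : 'rV[R]_dx) (y0 yd : 'rV[R]_dy).
Hypothesis cv : convex_set (feasible h x : set (convex_lmodType 'rV[R]_dy)).
Hypothesis fy0 : feasible h x y0.
Hypothesis fyd : feasible h x yd.
Let p0 := row_mx x y0.
Let pd := row_mx x yd.
Let dd : 'rV[R]_(dx + dy) := row_mx 0 (yd - y0).

Lemma segment_end : pd = p0 + dd.
Proof. by rewrite /pd /p0 /dd add_row_mx addr0 addrC subrK. Qed.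

Lemma segment_feasible (t : R) : 0 <= t <= 1 -> feasible_joint h (p0 + t *: dd).
Proof.
by move=> t01; rewrite /p0 /dd -row_mx_line; apply/feasible_row/feasible_segment.
Qed.

Lemma segment_dist (t : R) : 0 <= t <= 1 -> enorm (p0 + t *: dd - p0) <= enorm (yd - y0).
Proof.
move=> /andP[t0 t1]; rewrite addrC addKr enormZ ger0_norm // enorm_row_mx0l.
by rewrite ler_piMl ?enorm_ge0.
Qed.

Variables (F : 'rV[R]_dx -> 'rV[R]_dy -> R) (l1 l2 : R).
Hypothesis l1_ge0 : 0 <= l1.
Hypothesis l2_ge0 : 0 <= l2.
Hypothesis twF : forall q, feasible_joint h q -> twice_differentiable_at (joint F) q.
Hypothesis lipG : lipschitz_for (@enorm R _) (feasible_joint h) l1 (grad (joint F)).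
Hypothesis lipH : lipschitz_for (@opnorm R _ _) (feasible_joint h) l2 (hess (joint F)).

Lemma segment_grad : enorm (grad (joint F) pd - grad (joint F) p0) <= l1 * enorm (yd - y0).
Proof.
have := lipG ((feasible_row h x yd).2 fyd) ((feasible_row h x y0).2 fy0).
by rewrite -/pd -/p0 segment_end [p0 + _ - _]addrC addKr enorm_row_mx0l.
Qed.

(** Mean value theorem on the feasible segment, where the gradient is Lipschitz. *)
Lemma segment_value :
  `|F x yd - F x y0 - dot (grad (joint F) p0) dd| <= l1 * enorm (yd - y0) ^+ 2.
Proof.
rewrite -[F x yd]joint_row -[F x y0]joint_row -/pd -/p0 segment_end.
have [|c c01 ->] := @mean_value _ _ (joint F) p0 dd.
  by move=> t /segment_feasible /twF [/nbhs_singleton].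
rewrite -dotBl (le_trans (dot_norm_le _ _)) // enorm_row_mx0l expr2 mulrA.
rewrite ler_wpM2r ?enorm_ge0 //.
apply: le_trans (lipG (segment_feasible c01) ((feasible_row h x y0).2 fy0)) _.
by rewrite ler_wpM2l // segment_dist.
Qed.

Lemma segment_taylor :
  enorm (grad (joint F) pd - grad (joint F) p0 - dd *m hess (joint F) p0)
    <= l2 * enorm (yd - y0) ^+ 2.
Proof.
apply: enorm_le_dot; first by rewrite mulr_ge0 ?sqr_ge0.
move=> w; rewrite dotBl segment_end.
have [|c c01 ->] := @mean_value_grad _ _ (joint F) p0 dd w.
  by move=> t /segment_feasible /twF [].
rewrite -dotBl -mulmxBr (le_trans (dot_le _ _)) // ler_wpM2r ?enorm_ge0 //.
apply: le_trans (opnormP _ _) _; rewrite enorm_row_mx0l expr2 mulrA ler_wpM2r ?enorm_ge0 //.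
apply: le_trans (lipH (segment_feasible c01) ((feasible_row h x y0).2 fy0)) _.
by rewrite ler_wpM2l // segment_dist.
Qed.
End Segment.

Section Gap.
Variables (R : realType) (dx dy dh : nat) (f g : 'rV[R]_dx -> 'rV[R]_dy -> R)
  (h : 'I_dh -> 'rV[R]_dx -> 'rV[R]_dy -> R).
Variables (mu lf0 lf1 lf2 lg1 lg2 lh0 lh1 lh2 La s0 delta : R).
Hypothesis (mu_gt0 : 0 < mu) (s0_gt0 : 0 < s0) (delta_gt0 : 0 < delta) (La_ge0 : 0 <= La).
Hypothesis (lf0_ge0 : 0 <= lf0) (lf1_ge0 : 0 <= lf1) (lg1_ge0 : 0 <= lg1)
 (lg2_ge0 : 0 <= lg2) (lh0_ge0 : 0 <= lh0) (lh1_ge0 : 0 <= lh1) (lh2_ge0 : 0 <= lh2).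
Hypothesis r2 : R2 f g h lf0 lf1 lg1.
Hypothesis r4 : R4 f g h lf2 lg2 lh0 lh1 lh2.
Variables (x : 'rV[R]_dx) (y0 yd : 'rV[R]_dy) (lam e : 'rV[R]_dh).
Hypothesis cv : convex_set (feasible h x : set (convex_lmodType 'rV[R]_dy)).
Hypothesis fy0 : feasible h x y0.
Hypothesis fyd : feasible h x yd.
Let p0 := row_mx x y0.
Let pd := row_mx x yd.
Let d := yd - y0.
Let dd : 'rV[R]_(dx + dy) := row_mx 0 d.
Let I := active h x y0.
Let n := dh%:R : R.
Hypothesis ip0 : interior_limit h p0.
Hypothesis ipd : interior_limit h pd.
Hypothesis same_active : active h x yd = I.
Hypothesis lam_le : enorm lam <= La.
Hypothesis e_zero : forall i, i \notin I -> e ord0 i = 0.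
Hypothesis lower0 : forall w : 'rV[R]_dh, (forall i, i \notin I -> w ord0 i = 0) ->
  s0 * enorm w <= enorm (\sum_i w ord0 i *: grad_y (h i) x y0).
Hypothesis lowerd : forall w : 'rV[R]_dh, (forall i, i \notin I -> w ord0 i = 0) ->
  s0 * enorm w <= enorm (\sum_i w ord0 i *: grad_y (h i) x yd).
Let HL := lagrangian_hess h g x y0 lam.
Hypothesis coer : forall v, mu * enorm v ^+ 2 <= dot (row_mx 0 v *m HL) (row_mx 0 v).
Variables (M : 'M[R]_(dx, dy)) (N : 'M[R]_(dx, dh)).
Hypothesis lin : linearized h g x y0 lam M N.

(** The x-part is delta * grad Phi_delta, by the envelope formula at the parameters delta and 0; the
    y-part is the difference of the two stationarity conditions.  Here e stands for the difference
    of the multipliers. *)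
Definition gap_vector := delta *: grad (joint f) pd + grad (joint g) pd +
  \sum_i (lam + e) ord0 i *: grad (joint (h i)) pd -
  (grad (joint g) p0 + \sum_i lam ord0 i *: grad (joint (h i)) p0).
Hypothesis stat : rsubmx gap_vector = 0.

(** Successively: bounds for the Hessian of the Lagrangian at p0, for |y_delta - y_0| / delta, for
    |lambda_delta - lambda_0| / delta, for the coupling of h and the multiplier in the coercivity
    estimate of linear_bounds, for M, for N, for the remainder E, and the final constant. *)
Definition hess_const := lg1 + n * La * lh1.
Definition dist_const := 2 / mu * lf0.
Definition mult_const := (lf0 + hess_const * dist_const) / s0.
Definition cross_const := n * lh0 * (hess_const / s0).
Definition y_const := 1 + (hess_const + cross_const + cross_const) / mu.
Definition n_const := hess_const / s0 * (1 + y_const).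
Definition err_const := lf1 * dist_const + (lg2 + n * La * lh2) * dist_const ^+ 2
  + n * mult_const * lh1 * dist_const.
Definition gap_const := err_const * (1 + y_const) + n * n_const * lh1 * dist_const ^+ 2.

Hypothesis d_le : enorm d <= dist_const * delta.

Let Dp0 : feasible_joint h p0 := (feasible_row h x y0).2 fy0.
Let Dpd : feasible_joint h pd := (feasible_row h x yd).2 fyd.

Lemma n_ge0 : 0 <= n. Proof. exact: ler0n. Qed.

Lemma hess_const_ge0 : 0 <= hess_const.
Proof. by rewrite addr_ge0 // !mulr_ge0 // n_ge0. Qed.

Lemma dist_const_ge0 : 0 <= dist_const.
Proof. by rewrite mulr_ge0 // divr_ge0 // ltW. Qed.

Lemma gap_const_ge0 : 0 <= gap_const.
Proof.
have hc := hess_const_ge0; have dc := dist_const_ge0; have n0 := n_ge0.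
have si : 0 <= s0^-1 by rewrite invr_ge0 ltW.
have mi : 0 <= mu^-1 by rewrite invr_ge0 ltW.
have mc : 0 <= mult_const by apply: mulr_ge0 si; apply: addr_ge0 => //; exact: mulr_ge0.
have cc : 0 <= cross_const by apply: mulr_ge0 (mulr_ge0 hc si); exact: mulr_ge0.
have yc : 0 <= y_const.
  by apply: addr_ge0 => //; apply: mulr_ge0 mi; do 2 apply: addr_ge0 => //.
have nc : 0 <= n_const by apply: mulr_ge0 (mulr_ge0 hc si) _; exact: addr_ge0.
apply: addr_ge0; last by rewrite mulr_ge0 ?sqr_ge0 // mulr_ge0 // mulr_ge0.
apply: mulr_ge0; last exact: addr_ge0.
apply: addr_ge0; last by rewrite mulr_ge0 // mulr_ge0 // mulr_ge0.
apply: addr_ge0; first exact: mulr_ge0.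
rewrite mulr_ge0 ?sqr_ge0 // addr_ge0 // mulr_ge0 // mulr_ge0 //.
Qed.

Lemma HL_bound v : enorm (v *m HL) <= hess_const * enorm v.
Proof.
rewrite /HL /lagrangian_hess mulmxDr (le_trans (enormD _ _)) // /hess_const mulrDl.
case: r2 => _ _ lipg; case: r4 => _ _ lipg2 lh; apply: lerD.
  exact: (hess_bound lg2_ge0 (g_twice r4) lipg lipg2 Dp0 ip0 v).
rewrite mulmx_sumr.
have -> : \sum_i v *m (lam ord0 i *: hess (joint (h i)) (row_mx x y0)) =
    \sum_i lam ord0 i *: (v *m hess (joint (h i)) (row_mx x y0)).
  by apply: eq_bigr => i _; rewrite scalemxAr.
have B i : enorm (v *m hess (joint (h i)) (row_mx x y0)) <= lh1 * enorm v.
  have [twh _ _ l1 l2] := lh i.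
  exact: (hess_bound lh2_ge0 twh l1 l2 Dp0 ip0 v).
apply: le_trans (enorm_sum_mul lam B) _; rewrite -/n -!mulrA ler_wpM2l ?n_ge0 //.
by rewrite ler_wpM2r // mulr_ge0 ?enorm_ge0.
Qed.

Lemma HL_sym u v : dot (u *m HL) v = dot (v *m HL) u.
Proof.
rewrite /HL /lagrangian_hess !dot_mulmx_comb.
congr (_ + _); first exact: hess_sym (g_twice r4 Dp0).
by apply: eq_bigr => i _; congr (_ * _); exact: hess_sym (h_twice r4 i Dp0).
Qed.

Lemma active_grad_bound i : enorm (grad (joint (h i)) p0) <= lh0.
Proof.
case: r4 => _ _ _ lh; have [twh _ l0 l1 _] := lh i.
exact: (grad_bound lh0_ge0 lh1_ge0 twh l0 l1 Dp0 ip0).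
Qed.

(** The first equation bounds xi N by xi and xi M, through the lower bound on the singular values.
    Pairing it with (0, xi M) and using coercivity bounds |xi M|^2 by products of |xi| with |xi M|
    and |xi N|, where the linearized constraints trade the y-gradients of h for x-gradients. *)
Lemma linear_bounds xi :
  enorm (xi *m M) <= y_const * enorm xi /\ enorm (xi *m N) <= n_const * enorm xi.
Proof.
set u := xi *m M; set w := xi *m N.
have [L1 L2 L3] := lin xi; rewrite -/u -/w -/HL -/p0 in L1 L2 L3.
have sw := lower0 L3.
have NE : \sum_i w ord0 i *: grad_y (h i) x y0 = - rsubmx (row_mx xi u *m HL).
  by apply/eqP; rewrite -addr_eq0 addrC L1.
have nle : enorm w <= hess_const / s0 * (enorm xi + enorm u).
  rewrite mulrAC ler_pdivlMr // mulrC (le_trans sw) // NE enormN.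
  rewrite (le_trans (enorm_rsubmx _)) // (le_trans (HL_bound _)) //.
  by rewrite ler_wpM2l ?hess_const_ge0 // enorm_row_mx.
have ule : enorm u <= y_const * enorm xi.
  have cc0 : 0 <= cross_const by rewrite !mulr_ge0 ?n_ge0 ?hess_const_ge0 ?invr_ge0 ?(ltW s0_gt0).
  have hc0 := hess_const_ge0.
  have a0 : 0 <= hess_const + cross_const by rewrite addr_ge0.
  apply: (quadratic_bound a0 cc0 (enorm_ge0 _) (enorm_ge0 _) mu_gt0).
  apply: le_trans (coer u) _.
  have uE : row_mx 0 u = row_mx xi u - row_mx xi 0.
    by rewrite -[- row_mx _ _]scaleN1r scale_row_mx add_row_mx scaleN1r subrr scaler0 addr0.
  have c1 : dot (row_mx 0 u *m HL) (row_mx 0 u) =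
      \sum_i w ord0 i * dot (grad (joint (h i)) p0) (row_mx xi 0)
      - dot (row_mx xi 0 *m HL) (row_mx 0 u).
    rewrite {1}uE mulmxBl dotBl; congr (_ - _).
    rewrite dot_sub row_mxKl row_mxKr dot0r add0r.
    have -> : rsubmx (row_mx xi u *m HL) = - \sum_i w ord0 i *: grad_y (h i) x y0.
      by rewrite NE opprK.
    rewrite dotNl dot_suml -sumrN; apply: eq_bigr => i _; rewrite dotZl -mulrN.
    have [iI|iI] := boolP (i \in I); last by rewrite L3 // !mul0r.
    congr (_ * _); apply/eqP; rewrite eq_sym -addr_eq0 dot_grad_y -dotDr add_row_mx.
    by rewrite addr0 add0r L2.
  rewrite c1.
  have B i : `|dot (grad (joint (h i)) p0) (row_mx xi 0)| <= lh0 * enorm xi.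
    rewrite (le_trans (dot_norm_le _ _)) // enorm_row_mx0r.
    by rewrite ler_wpM2r ?enorm_ge0 // active_grad_bound.
  have B1 := le_trans (ler_norm _) (norm_sum_mul w B).
  have B2 : - dot (row_mx xi 0 *m HL) (row_mx 0 u) <= hess_const * enorm xi * enorm u.
    rewrite -dotNl (le_trans (dot_le _ _)) // enormN enorm_row_mx0l.
    by rewrite ler_wpM2r ?enorm_ge0 // (le_trans (HL_bound _)) // enorm_row_mx0r.
  apply: le_trans (lerD B1 B2) _.
  have B3 : n * enorm w * (lh0 * enorm xi) <=
      n * (hess_const / s0 * (enorm xi + enorm u)) * (lh0 * enorm xi).
    by rewrite ler_wpM2r ?mulr_ge0 ?enorm_ge0 // ler_wpM2l ?n_ge0.
  apply: le_trans (lerD B3 (lexx _)) _; rewrite /cross_const.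
  by rewrite le_eqVlt; apply/orP; left; apply/eqP; ring.
split=> //; apply: le_trans nle _.
rewrite /n_const -[leRHS]mulrA ler_wpM2l ?divr_ge0 ?hess_const_ge0 ?(ltW s0_gt0) //.
by rewrite mulrDl mul1r lerD2l.
Qed.

(** The difference of the two stationarity conditions expresses the combination of the active
    gradients at y_delta with weights e by terms of size O(delta). *)
Lemma mult_le : enorm e <= mult_const * delta.
Proof.
rewrite /mult_const mulrAC ler_pdivlMr // mulrC.
have := lowerd e_zero; move=> /le_trans -> //.
case: r2 => lipf lipf1 lipg1; case: r4 => _ _ _ lh.
have -> : \sum_i e ord0 i *: grad_y (h i) x yd =
   - rsubmx (delta *: grad (joint f) pd + (grad (joint g) pd - grad (joint g) p0) +
     \sum_i lam ord0 i *: (grad (joint (h i)) pd - grad (joint (h i)) p0)).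
  have -> : \sum_i e ord0 i *: grad_y (h i) x yd =
      rsubmx (\sum_i e ord0 i *: grad (joint (h i)) pd).
    by rewrite linear_sum; apply: eq_bigr => i _; rewrite grad_yE linearZ.
  apply/eqP; rewrite -addr_eq0 -linearD /=; apply/eqP; rewrite -[RHS]stat; congr rsubmx.
  rewrite /gap_vector.
  have -> : \sum_i (lam + e) ord0 i *: grad (joint (h i)) pd =
      \sum_i lam ord0 i *: grad (joint (h i)) pd + \sum_i e ord0 i *: grad (joint (h i)) pd.
    by rewrite -big_split; apply: eq_bigr => i _; rewrite mxE scalerDl.
  have -> : \sum_i lam ord0 i *: (grad (joint (h i)) pd - grad (joint (h i)) p0) =
      \sum_i lam ord0 i *: grad (joint (h i)) pd - \sum_i lam ord0 i *: grad (joint (h i)) p0.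
    by rewrite -sumrB; apply: eq_bigr => i _; rewrite scalerBr.
  move: (\sum_i _) (\sum_i _) (\sum_i _) (delta *: grad (joint f) pd) (grad (joint g) pd) (grad (joint g) p0) => *.
  by apply/rowP => ?; rewrite !mxE; ring.
rewrite enormN (le_trans (enorm_rsubmx _)) // (le_trans (enormD _ _)) //.
have A1 : enorm (delta *: grad (joint f) pd) <= lf0 * delta.
  rewrite enormZ gtr0_norm // mulrC ler_wpM2r ?(ltW delta_gt0) //.
  exact: (grad_bound lf0_ge0 lf1_ge0 (f_twice r4) lipf lipf1 Dpd ipd).
have A2 := segment_grad fy0 fyd lipg1; rewrite -/d -/pd -/p0 in A2.
have B i : enorm (grad (joint (h i)) pd - grad (joint (h i)) p0) <= lh1 * enorm d.
  by have [_ _ _ l1 _] := lh i; exact: (segment_grad fy0 fyd l1).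
have A3 := enorm_sum_mul lam B.
have A4 : n * enorm lam * (lh1 * enorm d) <= n * La * (lh1 * enorm d).
  by rewrite ler_wpM2r ?mulr_ge0 ?enorm_ge0 // ler_wpM2l ?n_ge0.
apply: le_trans (lerD (le_trans (enormD _ _) (lerD A1 A2)) (le_trans A3 A4)) _.
rewrite [leLHS](_ : _ = lf0 * delta + hess_const * enorm d); last by rewrite /hess_const; ring.
rewrite [leRHS]mulrDl lerD2l -mulrA ler_wpM2l ?hess_const_ge0 //.
Qed.

(** Linearization at p0 of gap_vector, minus gap_vector itself. *)
Definition error_vector := delta *: grad (joint f) p0 + dd *m HL +
  \sum_i e ord0 i *: grad (joint (h i)) p0 - gap_vector.

Lemma error_le : enorm error_vector <= err_const * delta ^+ 2.
Proof.
case: r2 => lipf lipf1 lipg1; case: r4 => _ _ lipg2 lh.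
pose T F := grad (joint F) pd - grad (joint F) p0 - dd *m hess (joint F) p0.
have E : error_vector = - (delta *: (grad (joint f) pd - grad (joint f) p0) + T g +
    \sum_i lam ord0 i *: T (h i) + \sum_i e ord0 i *: (grad (joint (h i)) pd - grad (joint (h i)) p0)).
  rewrite /error_vector /gap_vector /HL /lagrangian_hess mulmxDr mulmx_sumr -/p0.
  have -> : \sum_i dd *m (lam ord0 i *: hess (joint (h i)) p0) =
      \sum_i lam ord0 i *: (dd *m hess (joint (h i)) p0).
    by apply: eq_bigr => i _; rewrite scalemxAr.
  have -> : \sum_i (lam + e) ord0 i *: grad (joint (h i)) pd =
      \sum_i lam ord0 i *: grad (joint (h i)) pd + \sum_i e ord0 i *: grad (joint (h i)) pd.
    by rewrite -big_split; apply: eq_bigr => i _; rewrite mxE scalerDl.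
  have -> : \sum_i e ord0 i *: (grad (joint (h i)) pd - grad (joint (h i)) p0) =
      \sum_i e ord0 i *: grad (joint (h i)) pd - \sum_i e ord0 i *: grad (joint (h i)) p0.
    by rewrite -sumrB; apply: eq_bigr => i _; rewrite scalerBr.
  have -> : \sum_i lam ord0 i *: T (h i) =
      \sum_i lam ord0 i *: grad (joint (h i)) pd - \sum_i lam ord0 i *: grad (joint (h i)) p0
      - \sum_i lam ord0 i *: (dd *m hess (joint (h i)) p0).
    by rewrite -!sumrB; apply: eq_bigr => i _; rewrite /T !scalerBr.
  rewrite /T.
  move: (\sum_i _) (\sum_i _) (\sum_i _) (\sum_i _) (\sum_i _) => S1 S2 S3 S4 S5.
  move: (dd *m _) (grad (joint f) pd) (grad (joint f) p0) (grad (joint g) pd) (grad (joint g) p0) => *.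
  by apply/rowP => ?; rewrite !mxE; ring.
rewrite E enormN; set q := enorm d.
have q0 : 0 <= q := enorm_ge0 d.
have A1 : enorm (delta *: (grad (joint f) pd - grad (joint f) p0)) <= delta * (lf1 * q).
  by rewrite enormZ gtr0_norm // ler_wpM2l ?(ltW delta_gt0) // (segment_grad fy0 fyd lipf1).
have A2 : enorm (T g) <= lg2 * q ^+ 2 := segment_taylor cv fy0 fyd lg2_ge0 (g_twice r4) lipg2.
have B i : enorm (T (h i)) <= lh2 * q ^+ 2.
  have [twh _ _ _ l2] := lh i; exact: (segment_taylor cv fy0 fyd lh2_ge0 twh l2).
have B' i : enorm (grad (joint (h i)) pd - grad (joint (h i)) p0) <= lh1 * q.
  by have [_ _ _ l1 _] := lh i; exact: (segment_grad fy0 fyd l1).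
have A3 := enorm_sum_mul lam B; have A4 := enorm_sum_mul e B'.
apply: le_trans (enormD _ _) _; apply: le_trans (lerD (enormD _ _) (lexx _)) _.
apply: le_trans (lerD (lerD (enormD _ _) (lexx _)) (lexx _)) _.
apply: le_trans (lerD (lerD (lerD A1 A2) A3) A4) _; rewrite -/n.
have D1 : 0 <= dist_const * delta by rewrite mulr_ge0 ?dist_const_ge0 // ltW.
have q2 : q ^+ 2 <= (dist_const * delta) ^+ 2 by rewrite ler_pXn2r ?nnegrE.
have C1 : delta * (lf1 * q) <= delta * (lf1 * (dist_const * delta)).
  by rewrite ler_wpM2l ?(ltW delta_gt0) // ler_wpM2l.
have C2 : lg2 * q ^+ 2 <= lg2 * (dist_const * delta) ^+ 2 by rewrite ler_wpM2l.
have C3 : n * enorm lam * (lh2 * q ^+ 2) <= n * La * (lh2 * (dist_const * delta) ^+ 2).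
  apply: ler_pM; rewrite ?mulr_ge0 ?n_ge0 ?enorm_ge0 ?sqr_ge0 //.
    by rewrite ler_wpM2l ?n_ge0.
  by rewrite ler_wpM2l.
have C4 : n * enorm e * (lh1 * q) <= n * (mult_const * delta) * (lh1 * (dist_const * delta)).
  apply: ler_pM; rewrite ?mulr_ge0 ?n_ge0 ?enorm_ge0 //.
    by rewrite ler_wpM2l ?n_ge0 // mult_le.
  by rewrite ler_wpM2l.
apply: le_trans (lerD (lerD (lerD C1 C2) C3) C4) _.
by rewrite /err_const le_eqVlt; apply/orP; left; apply/eqP; ring.
Qed.

(** h_i vanishes at both ends of the segment, so only the second-order remainder is left. *)
Lemma constraint_defect i : i \in I ->
  `|dot (grad_y (h i) x y0) d| <= lh1 * (dist_const * delta) ^+ 2.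
Proof.
move=> iI; case: r4 => _ _ _ lh; have [twh _ _ l1 _] := lh i.
have := segment_value cv fy0 fyd lh1_ge0 twh l1.
have h0 : h i x y0 = 0 by move: iI; rewrite inE => /eqP.
have hd : h i x yd = 0 by move: iI; rewrite -same_active inE => /eqP.
rewrite h0 hd subrr sub0r normrN -dot_grad_y -/d => /le_trans -> //.
rewrite ler_wpM2l // ler_pXn2r ?nnegrE ?enorm_ge0 //.
by rewrite mulr_ge0 ?dist_const_ge0 // ltW.
Qed.

(** Pairing gap_vector with t = (xi, xi M) sees only its x-part.  In its linearization the term
    <dd HL, t> is transferred by symmetry to the linearized stationarity condition, leaving the
    defects of the constraints along d, and the terms in e vanish by the linearized constraints. *)
Lemma gap_le xi :
  delta * dot (grad (joint f) p0) (row_mx xi (xi *m M)) - dot (lsubmx gap_vector) xi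
    <= gap_const * delta ^+ 2 * enorm xi.
Proof.
set u := xi *m M; set w := xi *m N; set t := row_mx xi u.
have [L1 L2 L3] := lin xi; rewrite -/u -/w -/HL -/p0 -/t in L1 L2 L3.
have [uB wB] := linear_bounds xi; rewrite -/u -/w in uB wB.
have gE : dot (lsubmx gap_vector) xi = dot gap_vector t.
  by rewrite (dot_sub gap_vector) stat dot0l addr0 /t row_mxKl.
have eE : dot (\sum_i e ord0 i *: grad (joint (h i)) p0) t = 0.
  rewrite dot_suml big1 // => i _; rewrite dotZl.
  by have [/L2 ->|/e_zero ->] := boolP (i \in I); rewrite ?mulr0 ?mul0r.
have hE : dot (dd *m HL) t = - \sum_i w ord0 i * dot (grad_y (h i) x y0) d.
  rewrite HL_sym (dot_sub (t *m HL)) row_mxKl row_mxKr dot0r add0r.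
  have -> : rsubmx (t *m HL) = - \sum_i w ord0 i *: grad_y (h i) x y0.
    by apply/eqP; rewrite -addr_eq0 L1.
  by rewrite dotNl dot_suml; congr (- _); apply: eq_bigr => i _; rewrite dotZl.
have -> : delta * dot (grad (joint f) p0) t - dot (lsubmx gap_vector) xi =
    dot error_vector t + \sum_i w ord0 i * dot (grad_y (h i) x y0) d.
  have D4 (a b c q : 'rV[R]_(dx + dy)) : dot (delta *: a + b + c - q) t =
    delta * dot a t + dot b t + dot c t - dot q t by rewrite dotBl !dotDl dotZl.
  have -> : dot error_vector t = delta * dot (grad (joint f) p0) t + dot (dd *m HL) t +
    dot (\sum_i e ord0 i *: grad (joint (h i)) p0) t - dot gap_vector t by exact: D4.
  by rewrite gE eE hE; ring.
pose a i := if i \in I then dot (grad_y (h i) x y0) d else 0.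
have -> : \sum_i w ord0 i * dot (grad_y (h i) x y0) d = \sum_i w ord0 i * a i.
  by apply: eq_bigr => i _; rewrite /a; case: ifPn => // /L3 ->; rewrite !mul0r.
have aB i : `|a i| <= lh1 * (dist_const * delta) ^+ 2.
  rewrite /a; case: ifPn => [/constraint_defect //|_].
  by rewrite normr0 mulr_ge0 ?sqr_ge0.
have B1 := le_trans (ler_norm _) (norm_sum_mul w aB).
have tB : enorm t <= (1 + y_const) * enorm xi.
  by rewrite (le_trans (enorm_row_mx _ _)) // mulrDl mul1r lerD2l.
have B2 := le_trans (dot_le error_vector t) (ler_pM (enorm_ge0 _) (enorm_ge0 _) error_le tB).
apply: le_trans (lerD B2 B1) _; rewrite -/n.
have B3 : n * enorm w * (lh1 * (dist_const * delta) ^+ 2) <=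
    n * (n_const * enorm xi) * (lh1 * (dist_const * delta) ^+ 2).
  apply: ler_wpM2r; first by rewrite mulr_ge0 ?sqr_ge0.
  by rewrite ler_wpM2l ?n_ge0.
apply: le_trans (lerD (lexx _) B3) _.
by rewrite /gap_const le_eqVlt; apply/orP; left; apply/eqP; ring.
Qed.

End Gap.

(** * The bound with a uniform constant *)

Lemma lipschitz_for_max (R : realType) n (V : zmodType) (N : V -> R) (D : set 'rV[R]_n) l
    (F : 'rV[R]_n -> V) : lipschitz_for N D l F -> lipschitz_for N D (Num.max l 0) F.
Proof.
move=> H p q Dp Dq; apply: le_trans (H p q Dp Dq) _.
by rewrite ler_wpM2r ?enorm_ge0 // le_max lexx.
Qed.

(** Negative Lipschitz constants are replaced by 0; the condition on delta survives because mu is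
    positive. *)
Lemma strong_range_max (R : realType) (mu l delta : R) : 0 < mu -> 0 < delta ->
  2 * l * delta <= mu -> strong_range mu (Num.max l 0) delta.
Proof.
move=> mu0 d0 H; split; first exact: ltW.
by rewrite /Num.max; case: ifP => _; rewrite ?mulr0 ?(ltW mu0) // mulrCA mulrC.
Qed.

Unset Implicit Arguments.

Theorem theorem4p9 (R : realType) (dh : nat)
    (mu lf0 lf1 lf2 lg1 lg2 lh0 lh1 lh2 Lam smax smin : R)
    (mu_gt0 : 0 < mu) (smin_gt0 : 0 < smin) :
  exists C : R,
  forall (dx dy : nat) (f g : 'rV[R]_dx -> 'rV[R]_dy -> R)
    (h : 'I_dh -> 'rV[R]_dx -> 'rV[R]_dy -> R) (delta : R) (x : 'rV[R]_dx),
  let I := active h x (ystar g h x) in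
  cont_diff (joint f) -> cont_diff (joint g) ->
  0 < delta -> 2 * lf1 * delta <= mu ->
  R1 f g h -> R2 f g h lf0 lf1 lg1 -> R3 g h mu ->
  R4 f g h lf2 lg2 lh0 lh1 lh2 ->
  (forall t : R, 0 <= t <= delta ->
     let y := ystar_t f g h t x in
     let lam := lambda_t f g h t x in
     [/\ LICQ h x y,
         active h x y = I,
         forall i, i \in I -> 0 < lam ord0 i &
         enorm lam <= Lam]) ->
  (forall t : R, 0 <= t <= delta ->
     forall s : R, singular_value (grad_bar h I x (ystar_t f g h t x)) s ->
       smin <= s <= smax) ->
  [/\ differentiable (Phi f g h) x,
      differentiable (Phi_delta f g h delta) x &
      enorm (grad (Phi f g h) x - grad (Phi_delta f g h delta) x)
        <= C * delta].
Proof.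
pose pos (l : R) := Num.max l 0.
have pos_ge0 l : 0 <= pos l by rewrite /pos le_max lexx orbT.
exists (gap_const dh mu (pos lf0) (pos lf1) (pos lg1) (pos lg2) (pos lh0) (pos lh1) (pos lh2)
  (pos Lam) smin).
move=> dx dy f g h delta x I cf cg delta0 hdelta r1 r2 r3 r4 hreg hsing.
have r2' : R2 f g h (pos lf0) (pos lf1) (pos lg1).
  case: r2 => A B C.
  by split; [exact: lipschitz_for_max A | exact: lipschitz_for_max B | exact: lipschitz_for_max C].
have r4' : R4 f g h (pos lf2) (pos lg2) (pos lh0) (pos lh1) (pos lh2).
  case: r4 => A B C D; split; [exact: A | exact: lipschitz_for_max B |
    exact: lipschitz_for_max C |] => i.
  have [D1 D2 D3 D4 D5] := D i; split; [exact: D1 | exact: D2 | exact: lipschitz_for_max D3 |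
    exact: lipschitz_for_max D4 | exact: lipschitz_for_max D5].
have sd : strong_range mu (pos lf1) delta.
  exact: strong_range_max.
have s0 := @strong_range0 R mu (pos lf1) mu_gt0.
have t0 : 0 <= (0 : R) <= delta by rewrite lexx ltW.
have td : 0 <= delta <= delta by rewrite lexx andbT ltW.
set y0 := ystar_t f g h 0 x; set yd := ystar_t f g h delta x.
set lam0 := lambda_t f g h 0 x; set lamd := lambda_t f g h delta x.
have IE : active h x y0 = I by rewrite /I (ystarE f).
have [licq0 _ lp0 ll0] := hreg _ t0; have [licqd IEd lpd _] := hreg _ td.
rewrite -/y0 -/lam0 in licq0 lp0 ll0; rewrite -/yd -/lamd in licqd IEd lpd.
have sing0 s : singular_value (grad_bar h (active h x y0) x y0) s -> smin <= s.
  by rewrite IE => /(hsing _ t0)/andP[].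
have singd s : singular_value (grad_bar h (active h x yd) x yd) s -> smin <= s.
  by rewrite IEd => /(hsing _ td)/andP[].
have lp0' i : i \in active h x y0 -> 0 < lam0 ord0 i by rewrite IE; exact: lp0.
have lpd' i : i \in active h x yd -> 0 < lamd ord0 i by rewrite IEd; exact: lpd.
have fy0 : feasible h x y0 := (ystar_t_min mu_gt0 cf cg r1 r2' r3 x s0).1.
have fyd : feasible h x yd := (ystar_t_min mu_gt0 cf cg r1 r2' r3 x sd).1.
have [M [N [lin so]]] := ystar_t_sensitivity mu_gt0 (pos_ge0 _) (pos_ge0 _) (pos_ge0 _)
  cf cg r1 r2' r3 r4' s0 licq0 lp0' smin_gt0 sing0.
have [dV0 gV0] := value_diff mu_gt0 (pos_ge0 _) (pos_ge0 _) (pos_ge0 _)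
  cf cg r1 r2' r3 r4' s0 licq0 lp0' smin_gt0 sing0.
have [dVd gVd] := value_diff mu_gt0 (pos_ge0 _) (pos_ge0 _) (pos_ge0 _)
  cf cg r1 r2' r3 r4' sd licqd lpd' smin_gt0 singd.
have coer := lagrangian_coercive mu_gt0 (pos_ge0 _) (pos_ge0 _) (pos_ge0 _)
  cf cg r1 r2' r3 r4' s0 licq0 smin_gt0 sing0.
have ip0 := ystar_t_interior mu_gt0 cf cg r1 r2' r3 r4' s0 licq0 smin_gt0 sing0.
have ipd := ystar_t_interior mu_gt0 cf cg r1 r2' r3 r4' sd licqd smin_gt0 singd.
have [lam0_ge0 stat0 lam0z] := lambda_t_KKT mu_gt0 cf cg r1 r2' r3 r4' s0 licq0 smin_gt0 sing0.
have [lamd_ge0 statd lamdz] := lambda_t_KKT mu_gt0 cf cg r1 r2' r3 r4' sd licqd smin_gt0 singd.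
have low0 := multiplier_lower licq0 smin_gt0 sing0.
have lowd := multiplier_lower licqd smin_gt0 singd.
rewrite -/y0 -/yd -/lam0 -/lamd in lin so gV0 gVd coer ip0 ipd stat0 statd lam0z lamdz lam0_ge0 lamd_ge0 low0 lowd.
rewrite penalized0 in lin stat0 coer; rewrite mul0r subr0 in coer.
have dle : enorm (yd - y0) <= dist_const mu (pos lf0) * delta.
  have Gfoc := g_first_order cg r3.
  have ymin x' z : feasible h x' z -> g x' (ystar_t f g h 0 x') <= g x' z.
    by have := (ystar_t_min mu_gt0 cf cg r1 r2' r3 x' s0).2 z; rewrite penalized0.
  have comp i : lamd ord0 i * h i x yd = 0.
    have [|/lamdz ->] := boolP (i \in active h x yd); last by rewrite mul0r.
    by rewrite inE => /eqP ->; rewrite mulr0.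
  have := near_stationary mu_gt0 Gfoc (h_first_order r4')
    (fun x' => (ystar_t_min mu_gt0 cf cg r1 r2' r3 x' s0).1) ymin fyd lamd_ge0 comp.
  have -> : grad_y g x yd + \sum_i lamd ord0 i *: grad_y (h i) x yd = - (delta *: grad_y f x yd).
    by apply/eqP; rewrite -addr_eq0 addrC addrA -(penalized_grad_y cf cg) statd.
  rewrite -/y0 enormB enormN enormZ gtr0_norm // => /le_trans -> //.
  rewrite /dist_const -[leRHS]mulrA ler_wpM2l ?divr_ge0 ?(ltW mu_gt0) // [leLHS]mulrC ler_wpM2r ?(ltW delta0) //.
  rewrite grad_yE (le_trans (enorm_rsubmx _)) //; case: r2' => lipf lipf1 _.
  exact: (grad_bound (pos_ge0 _) (pos_ge0 _) (f_twice r4') lipf lipf1 ((feasible_row h x yd).2 fyd) ipd).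
have PhiE : Phi f g h = fun x' => f x' (ystar_t f g h 0 x').
  by apply/funext => x'; rewrite /Phi (ystarE f).
have [dPhi gPhi] := composite_diff (cf.1 _) so; rewrite -PhiE -/y0 in dPhi gPhi.
have PdE : Phi_delta f g h delta = fun x' => delta^-1 *
    (penalized f g delta x' (ystar_t f g h delta x') - penalized f g 0 x' (ystar_t f g h 0 x')).
  by apply/funext => x'; exact: (Phi_deltaE mu_gt0 cf cg r1 r2' r3 x' delta0 sd).
have [dPd gPd] := grad_scaleB delta^-1 dVd dV0; rewrite -PdE in dPd gPd.
split; [exact: dPhi | exact: dPd |].
have eact : active h x yd = active h x y0 by rewrite IE.
have lamle : enorm lam0 <= pos Lam by rewrite /pos le_max ll0.
have [e eE] : exists e, e = lamd - lam0 by eexists.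
have le : lam0 + e = lamd by rewrite eE addrC subrK.
have ez i : i \notin active h x y0 -> e ord0 i = 0.
  by move=> iI; rewrite eE !mxE lam0z // lamdz ?subrr // eact.
clearbody y0 yd lam0 lamd.
have gv : grad (fun x' => penalized f g delta x' (ystar_t f g h delta x')) x -
    grad (fun x' => penalized f g 0 x' (ystar_t f g h 0 x')) x =
    lsubmx (gap_vector f g h delta x y0 yd lam0 e).
  by rewrite gVd gV0 /gap_vector le scale0r add0r linearB.
have gstat : rsubmx (gap_vector f g h delta x y0 yd lam0 e) = 0.
  have sumE (w : 'rV[R]_dh) y : \sum_i w ord0 i *: grad_y (h i) x y =
      rsubmx (\sum_i w ord0 i *: grad (joint (h i)) (row_mx x y)).
    by rewrite linear_sum; apply: eq_bigr => i _; rewrite grad_yE linearZ.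
  have E0 : rsubmx (grad (joint g) (row_mx x y0) +
      \sum_i lam0 ord0 i *: grad (joint (h i)) (row_mx x y0)) = 0.
    by rewrite linearD /= -sumE -grad_yE stat0.
  have Ed : rsubmx (delta *: grad (joint f) (row_mx x yd) + grad (joint g) (row_mx x yd) +
      \sum_i lamd ord0 i *: grad (joint (h i)) (row_mx x yd)) = 0.
    by rewrite linearD /= -sumE -(penalized_diff cf cg delta _).2 -grad_yE statd.
  have rB (a b : 'rV[R]_(dx + dy)) : rsubmx a = 0 -> rsubmx b = 0 -> rsubmx (a - b) = 0.
    by rewrite linearB /= => -> ->; rewrite subrr.
  by rewrite /gap_vector le; exact: rB.
have [_ _ cvx] := r1.1 x.
have lowd' (w : 'rV[R]_dh) : (forall i, i \notin active h x y0 -> w ord0 i = 0) ->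
    smin * enorm w <= enorm (\sum_i w ord0 i *: grad_y (h i) x yd).
  by rewrite -eact; exact: lowd.
apply: enorm_le_dot.
  apply: mulr_ge0 (ltW delta0); apply: gap_const_ge0 => //; exact: pos_ge0.
move=> xi; rewrite -(ler_pM2l delta0) gPd gv dotBl dotZl mulrBr gPhi mulrA divff ?gt_eqF // mul1r.
have step := gap_le mu_gt0 smin_gt0 delta0 (pos_ge0 Lam) (pos_ge0 _) (pos_ge0 _) (pos_ge0 _)
  (pos_ge0 _) (pos_ge0 _) (pos_ge0 _) (pos_ge0 _) r2' r4' cvx fy0 fyd ip0 ipd
  eact lamle ez low0 lowd' coer lin gstat dle xi.
apply: le_trans step _; rewrite le_eqVlt; apply/orP; left; apply/eqP.
by ring.
Qed.
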